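(* Let $\mathfrak{g}$ be a finite-dimensional complex Lie algebra, $\bar\rho:\mathrm{SL}(2,\mathbb{C})\to\mathrm{Aut}(\mathfrak{g})$ a representation, $\Gamma$ a polyhedral group, and $P$ a relatively invariant form of degree $|\Gamma|$ vanishing on a $\Gamma$-orbit $S$. Then $\Phi_{P,\bar\rho}$ realises an isomorphism of graded Lie algebras and of graded modules over $\mathbb{C}[X,Y,P^{-1}]^{B\Gamma}$, $$\mathfrak{g}\otimes_{\mathbb{C}}\mathbb{C}[X,Y,P^{-1}]^{B\Gamma}\xrightarrow{\ \Phi_{P,\bar\rho}\ }\mathfrak{g}[X,Y,P^{-1}]^{B\Gamma},$$ where $\mathfrak{g}$ on the left-hand side is endowed with the grading defined by minus the weights as an $\mathfrak{sl}(2,\mathbb{C})$-module (an element of $\mathfrak{g}_k$ has degree $-k$), and $\mathfrak{g}$ on the right-hand side has degree zero.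
   Context: $\Gamma\subset \mathrm{SO}(3)$ is a polyhedral group, i.e. a finite subgroup, and $B\Gamma\subset\mathrm{SU}(2)$ is its full preimage under the double cover $\mathrm{SU}(2)\to\mathrm{SO}(3)$, so $\Gamma\cong B\Gamma/\{\pm\mathrm{Id}\}$ acts on the Riemann sphere (the complex projective line of lines in $\mathbb{C}^2$). $S$ is one of its orbits. $B\Gamma$ acts on $\mathbb{C}[X,Y]$ by $(\gamma f)(v)=f(\gamma^{-1}v)$, $v=(X,Y)^T$. $P\in\mathbb{C}[X,Y]$ is a homogeneous polynomial of degree $|\Gamma|$ with zero set (the lines corresponding to) $S$, relatively invariant in the sense that each $\gamma\in B\Gamma$ multiplies it by a scalar; such $P$ is unique up to a nonzero scalar. $\mathfrak{g}[X,Y,P^{-1}]=\mathfrak{g}\otimes_{\mathbb{C}}\mathbb{C}[X,Y,P^{-1}]$ with the $\mathbb{C}[X,Y,P^{-1}]$-bilinear Lie bracket extending that of $\mathfrak{g}$, graded by homogeneous degree in $X,Y$. $B\Gamma$ acts on it by $(\gamma\cdot f)(v)=\bar\rho(\gamma)f(\gamma^{-1}v)$, and the superscript $B\Gamma$ denotes invariants. $\bar\rho$ is a homomorphism of complex Lie groups, with derivative $\mathrm{d}\bar\rho:\mathfrak{sl}(2,\mathbb{C})\to\mathrm{Der}(\mathfrak{g})$; put $H=\mathrm{d}\bar\rho\begin{pmatrix}1&0\\0&-1\end{pmatrix}$, $E=\mathrm{d}\bar\rho\begin{pmatrix}0&1\\0&0\end{pmatrix}$, $F=\mathrm{d}\bar\rho\begin{pmatrix}0&0\\1&0\end{pmatrix}$,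 and let $\mathfrak{g}_k$ be the eigenspace of $H$ with eigenvalue $k$. Define $$\Phi_{P,1}(X,Y)=\begin{pmatrix}\frac{\partial_YP}{\deg(P)P}&X\\[2mm]-\frac{\partial_XP}{\deg(P)P}&Y\end{pmatrix},$$ which has determinant $1$ outside the zeros of $P$, and $\Phi_{P,\bar\rho}=\bar\rho(\Phi_{P,1})$, that is, $$\Phi_{P,\bar\rho}(X,Y)=\exp\!\Big[\tfrac{X}{Y}E\Big]\exp\!\Big[-\tfrac{Y\partial_XP}{\deg(P)P}F\Big]\exp[-\ln(Y)H],$$ where $\exp[-\ln(Y)H]$ denotes the operator multiplying $\mathfrak{g}_k$ by $Y^{-k}$. It acts $\mathbb{C}[X,Y,P^{-1}]$-linearly on $\mathfrak{g}[X,Y,P^{-1}]$, i.e. $x\otimes f\mapsto f\,\Phi_{P,\bar\rho}(x)$. *)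

(* Defs.v *)
From HB Require Import structures.
From mathcomp Require Import all_boot all_order all_algebra complex finmap.
From mathcomp Require Import all_classical all_reals topology normedtype derive.
From mathcomp Require mpoly.
(* The notations of multinomials clash with those of mathcomp-analysis. *)
Import -(notations) mpoly.

Set Implicit Arguments.
Unset Strict Implicit.
Unset Printing Implicit Defensive.

Import Order.TTheory GRing.Theory Num.Theory numFieldNormedType.Exports.

Local Open Scope classical_set_scope.
Local Open Scope ring_scope.
Local Open Scope sesquilinear_scope.

(* The complex numbers are [R[i]] for a [realType] R.  The topologies of C and
   of M_2(C) are only inferred through the [numFieldType] structure of [R[i]],
   or through the alias [R[i]^o]. *)

Definition mat2 (K : pzRingType) (a b c d : K) : 'M[K]_2 :=
  \matrix_(i, j) nth 0 (nth [::] [:: [:: a; b]; [:: c; d]] i) j.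

Section LieRepresentations.
Variables (R : realType) (g : vectType R[i]) (br : g -> g -> g).
Local Notation C := (R[i] : numFieldType).

Record lie_bracket : Prop := LieBracket {
  br_linearl : forall y, linear (fun x => br x y);
  br_linearr : forall x, linear (br x);
  br_alt : forall x, br x x = 0;
  br_jacobi : forall x y z, br x (br y z) + br y (br z x) + br z (br x y) = 0
}.

(* [rho] stands for a map on SL(2,C): its values at matrices of determinant
   different from 1 are never used. *)
Variable rho : 'M[R[i]]_2 -> 'End(g).

(* Holomorphy on the closed submanifold SL(2,C) of M_2(C): near each point,
   [rho] is the restriction of a holomorphic map defined on an open subset of
   M_2(C).  Maps to the finite-dimensional space End(g) are tested against
   vectors and linear functionals. *)
Definition holomorphic_on_SL2 : Prop :=
  forall A : 'M[C]_2, \det A = 1 ->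
  exists F : 'M[R[i]]_2 -> 'End(g), \forall B \near A,
    (\det B = 1 -> F B = rho B) /\
    forall (x : g) (l : 'Hom(g, R[i]^o)),
      differentiable (fun A' : 'M[C]_2 => l (F A' x)) (B : 'M[C]_2).

(* Invertibility of [rho A] follows from the first two fields. *)
Record lie_aut_rep : Prop := LieAutRep {
  rep1 : rho 1%:M = \1%VF;
  repM : forall A B, \det A = 1 -> \det B = 1 ->
    rho (A *m B) = (rho A \o rho B)%VF;
  rep_br : forall A, \det A = 1 ->
    forall x y, rho A (br x y) = br (rho A x) (rho A y);
  rep_holomorphic : holomorphic_on_SL2
}.

(* [D] is the differential of [rho] at the identity in the direction [X]:
   the velocity at 0 of [rho \o c] for every curve [c] in SL(2,C) through the
   identity with velocity [X]. *)
Definition is_drho (X : 'M[R[i]]_2) (D : 'End(g)) : Prop :=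
  forall c : C -> 'M[C]_2,
    c 0 = 1%:M -> (\forall t \near (0 : C), \det (c t) = 1) ->
    is_derive (0 : C) (1 : C) c X ->
    forall (x : g) (l : 'Hom(g, R[i]^o)),
      is_derive (0 : C) (1 : C) (fun t => l (rho (c t) x)) (l (D x)).

Definition drho (X : 'M[R[i]]_2) : 'End(g) := xget 0 [set D | is_drho X D].

Definition weight_space (k : int) : {vspace g} :=
  passmx.leigenspace (drho (mat2 1 0 0 (-1))) k%:~R.

End LieRepresentations.

Section PolyhedralGroups.
Variable R : realType.

Definition polyhedral (Gamma : {fset 'M[R]_3}) : Prop :=
  [/\ forall A, A \in Gamma -> A *m A^T = 1%:M /\ \det A = 1,
      1%:M \in Gamma,
      forall A B, A \in Gamma -> B \in Gamma -> A *m B \in Gamma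
    & forall A, A \in Gamma -> invmx A \in Gamma].

Definition pauli (k : 'I_3) : 'M[R[i]]_2 :=
  nth 0 [:: mat2 0 1 1 0; mat2 0 (- 'i%C) 'i%C 0; mat2 1 0 0 (-1)] k.

(* The double cover SU(2) -> SO(3): the matrix, in the basis of Pauli matrices,
   of the conjugation action of A on traceless Hermitian matrices. *)
Definition spin_cover (A : 'M[R[i]]_2) : 'M[R]_3 :=
  \matrix_(j, k) complex.Re (2^-1 * \tr (pauli j *m (A *m pauli k *m A ^t*))).

Definition binary_group (Gamma : {fset 'M[R]_3}) : set 'M[R[i]]_2 :=
  [set A | [/\ A \is unitarymx, \det A = 1 & spin_cover A \in Gamma]].

(* Orbits on the Riemann sphere; its points are the lines of C^2. *)
Definition is_orbit (G : set 'M[R[i]]_2) (S : set {vspace 'cV[R[i]]_2}) : Prop :=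
  exists2 L : {vspace 'cV[R[i]]_2}, \dim L = 1%N &
    S = [set (linfun (mulmx A) @: L)%VS | A in G].

End PolyhedralGroups.

Section Forms.
Variable R : realType.
Implicit Types (p q P : mpoly 2 R[i]) (v : 'cV[R[i]]_2).

Definition polyeval p v : R[i] := meval (fun i => v i 0) p.

Definition homogeneous (d : nat) p : bool :=
  p \is ishomog1 d mdeg.

Definition total_degree p : nat := (msize p).-1.

Definition relatively_invariant (G : set 'M[R[i]]_2) P : Prop :=
  forall A, G A -> exists c : R[i],
    forall v, polyeval P (invmx A *m v) = c * polyeval P v.

Definition zero_set P : set {vspace 'cV[R[i]]_2} :=
  [set L | exists2 v, v != 0 & polyeval P v = 0 /\ L = <[v]>%VS].

(* The complement in C^2 of the zeros of P. *)
Definition nonzeros P : Type := {v : 'cV[R[i]]_2 | polyeval P v != 0}.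

(* C[X,Y,P^-1], as a ring of functions on the complement of the zeros of P. *)
Definition laurent P : set (nonzeros P -> R[i]) :=
  [set f | exists q n,
     forall u, f u = polyeval q (val u) / polyeval P (val u) ^+ n].

(* Its component of degree d; [homogeneous m 0] holds for every m. *)
Definition laurent_deg P (d : int) : set (nonzeros P -> R[i]) :=
  [set f | exists q m n,
     [/\ homogeneous m q, d = m%:Z - (n * total_degree P)%:Z &
      forall u, f u = polyeval q (val u) / polyeval P (val u) ^+ n]].

(* Invariance under (A . f)(v) = act A (f (A^-1 v)).  If P is relatively
   invariant, then A^-1 v is a nonzero of P whenever v is. *)
Definition invariants P (G : set 'M[R[i]]_2) (T : Type)
    (act : 'M[R[i]]_2 -> T -> T) : set (nonzeros P -> T) :=
  [set f | forall A, G A -> forall u v : nonzeros P,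
     val u = invmx A *m val v -> act A (f u) = f v].

Definition Phi1 P v : 'M[R[i]]_2 :=
  let N := (total_degree P)%:R * polyeval P v in
  mat2 (  polyeval (mderiv ord_max P) v / N) (v 0 0)
       (- polyeval (mderiv ord0    P) v / N) (v ord_max 0).

Definition Phi P (g : vectType R[i]) (rho : 'M[R[i]]_2 -> 'End(g))
    (f : nonzeros P -> g) : nonzeros P -> g :=
  fun u => rho (Phi1 P (val u)) (f u).

End Forms.

Arguments laurent {R} P _.
Arguments laurent_deg {R} P d _.
Arguments invariants {R} P G {T} act _.
Arguments Phi {R} P {g} rho f _.

Section GradedModules.
Variables (R : realType) (g : vectType R[i]) (br : g -> g -> g) (U : Type).
Implicit Types (a : U -> R[i]) (f h : U -> g).

(* Elements of g (x) A, for a space A of functions on U, are represented by the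
   g-valued functions they define; [tensor_span T] is spanned by the x (x) a
   with (x, a) in T. *)
Definition tensor_span (T : set (g * (U -> R[i]))) : set (U -> g) :=
  [set f | exists m (t : 'I_m -> g * (U -> R[i])),
     (forall i, T (t i)) /\ forall u, f u = \sum_i (t i).2 u *: (t i).1].

Definition tensor (A : set (U -> R[i])) : set (U -> g) :=
  tensor_span ([set: g] `*` A).

Definition fscale a f : U -> g := fun u => a u *: f u.
Definition fadd f h : U -> g := fun u => f u + h u.
Definition fbr f h : U -> g := fun u => br (f u) (h u).

(* [M], with homogeneous components [Md], is a graded Lie algebra and a graded
   module over the ring [A] with homogeneous components [Ad]. *)
Record graded_lie_module (A : set (U -> R[i])) (Ad : int -> set (U -> R[i]))
    (M : set (U -> g)) (Md : int -> set (U -> g)) : Prop := GradedLieModule {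
  gm_add : forall f h, M f -> M h -> M (fadd f h);
  gm_scale : forall a f, A a -> M f -> M (fscale a f);
  gm_br : forall f h, M f -> M h -> M (fbr f h);
  gm_sub : forall d, Md d `<=` M;
  gm0 : forall d, Md d (fun=> 0);
  gm_add_deg : forall d f h, Md d f -> Md d h -> Md d (fadd f h);
  gm_scale_deg : forall d e a f, Ad d a -> Md e f -> Md (d + e) (fscale a f);
  gm_br_deg : forall d e f h, Md d f -> Md e h -> Md (d + e) (fbr f h);
  gm_span : forall f, M f -> exists (s : seq int) (F : int -> U -> g),
    [/\ uniq s, forall d, Md d (F d) & forall u, f u = \sum_(d <- s) F d u];
  gm_direct : forall (s : seq int) (F : int -> U -> g),
    uniq s -> (forall d, Md d (F d)) -> (forall u, \sum_(d <- s) F d u = 0) ->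
    forall d, d \in s -> forall u, F d u = 0
}.

Record graded_lie_module_iso (A : set (U -> R[i])) (Ad : int -> set (U -> R[i]))
    (M : set (U -> g)) (Md : int -> set (U -> g))
    (N : set (U -> g)) (Nd : int -> set (U -> g))
    (phi : (U -> g) -> (U -> g)) : Prop := GradedLieModuleIso {
  iso_dom : graded_lie_module A Ad M Md;
  iso_cod : graded_lie_module A Ad N Nd;
  iso_bij : set_bij M N phi;
  iso_add : forall f h, M f -> M h -> phi (fadd f h) = fadd (phi f) (phi h);
  iso_scale : forall a f, A a -> M f -> phi (fscale a f) = fscale a (phi f);
  iso_br : forall f h, M f -> M h -> phi (fbr f h) = fbr (phi f) (phi h);
  iso_deg : forall d, phi @` Md d = Nd d
}.

End GradedModules.

Arguments tensor_span {R g U} T _.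
Arguments tensor {R} g {U} A _.

Section InvariantAlgebras.
Variables (R : realType) (g : vectType R[i]) (rho : 'M[R[i]]_2 -> 'End(g)).
Variables (G : set 'M[R[i]]_2) (P : mpoly 2 R[i]).

Definition inv_ring : set (nonzeros P -> R[i]) :=
  laurent P `&` invariants P G (fun _ c => c).

Definition inv_ring_deg (d : int) : set (nonzeros P -> R[i]) :=
  laurent_deg P d `&` invariants P G (fun _ c => c).

(* g (x) C[X,Y,P^-1]^G, where the weight space g_k has degree -k. *)
Definition source : set (nonzeros P -> g) := tensor g inv_ring.

Definition source_deg (d : int) : set (nonzeros P -> g) :=
  tensor_span [set t | exists2 k : int,
    t.1 \in weight_space rho k & inv_ring_deg (d + k) t.2].

(* g[X,Y,P^-1]^G, where g has degree 0. *)
Definition target : set (nonzeros P -> g) :=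
  tensor g (laurent P) `&` invariants P G (fun A x => rho A x).

Definition target_deg (d : int) : set (nonzeros P -> g) :=
  tensor g (laurent_deg P d) `&` invariants P G (fun A x => rho A x).

End InvariantAlgebras.

Arguments inv_ring {R} G P _.
Arguments inv_ring_deg {R} G P d _.
Arguments source {R} g G P _.
Arguments source_deg {R g} rho G P d _.
Arguments target {R g} rho G P _.
Arguments target_deg {R g} rho G P d _.

(* Main.v *)
Require Import Defs.
From HB Require Import structures.
From mathcomp Require Import all_boot all_order all_algebra complex finmap.
From mathcomp Require Import all_classical all_reals topology normedtype derive.
From mathcomp Require Import realfun sequences exp trigo.
From mathcomp Require Import ring lra.
From mathcomp Require mpoly.
Import -(notations) mpoly.

Set Implicit Arguments.
Unset Strict Implicit.
Unset Printing Implicit Defensive.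

Import Order.TTheory GRing.Theory Num.Theory numFieldNormedType.Exports.

Local Open Scope classical_set_scope.
Local Open Scope ring_scope.

(** At a point v where P does not vanish, [Phi1 P v] is a matrix of SL(2,C)
    whose second column is v itself and whose first column is the symplectic
    gradient of log P divided by deg P; Euler's identity says that its
    determinant is 1.  Two facts about this frame carry the theorem.

    - Equivariance ([Phi1_equivariant]).  A linear change of variables in
      SL(2,C) that multiplies P by a constant carries the frame at v to the
      frame at the image of v, because log P only changes by an additive
      constant.  Hence f is constant on the orbits of the group exactly when
      v |-> rho (Phi1 P v) (f v) is equivariant.
    - Homogeneity ([Phi1_scale]).  Replacing v by t v multiplies the frame on
      the right by diag(1/t, t), and [rho (diag(t, 1/t))] acts on the weight
      space g_k by t^k ([rho_torus_weight]).  This is where the grading of g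
      by minus the weights comes from.

    It remains to see that nothing leaves the ring C[X,Y,1/P], that is, that
    v |-> rho (Phi1 P v) x has coordinates in that ring, and likewise for the
    inverse matrix.  This follows from [rho_regular]: a holomorphic
    representation of SL(2,C) is algebraic, so rho applied to a matrix of
    determinant 1 with entries in an algebra of functions has matrix
    coefficients in that algebra.  Its proof has three steps.

    - The torus acts semisimply with integer weights ([weight_basis]).  The
      generator H of the torus is integrated along real one-parameter groups;
      the relation exp(2 pi i) = 1 forces the eigenvalues of H to be integers
      and excludes Jordan blocks.
    - A matrix coefficient f of the unipotent group, taken between weight
      vectors, satisfies f(t^2 s) = t^k f(s); being continuous at 0, it is a
      monomial ([homogeneous_monomial]).
    - On the open cells where an entry of the second column is invertible, a
      matrix is, up to the Weyl element, a product of unipotent and diagonal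
      ones, which gives the claim after localization; the two localizations are glued by a partition of
      unity ([localized_glue]).

    Finally the grading is handled through scaling: an element of C[X,Y,1/P]
    has degree d if and only if it is multiplied by t^d under v |-> t v
    ([laurent_degP]).  In these terms the homogeneous components of both sides
    are described by a scaling law ([source_degP], [target_degP]), and the two
    laws correspond to each other under Phi by the homogeneity of the frame. *)

(** * Complex-valued functions of a real variable *)

Section RealParameter.
Variable R : realType.
Local Notation C := (R[i] : numFieldType).
Local Notation rc := (real_complex R : R -> C).
Implicit Types (f g : R -> C) (s : R) (d : C).

(** The difference quotient is formed in C, so that products, and composition
    with holomorphic functions, reduce to the rules for limits in a field. *)
Definition rderiv f s d : Prop :=
  (fun h : R => (rc h)^-1 * (f (h + s) - f s)) @ (0 : R)^' --> d.

Lemma cvg_Re (T : Type) (F : set_system T) {FF : Filter F} (g : T -> C) d :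
  g @ F --> d -> (fun x => complex.Re (g x)) @ F --> complex.Re d.
Proof.
move=> gd; apply/cvgrPdist_lt => e e0.
have e0' : 0 < rc e by rewrite ltcR.
move/cvgrPdist_lt: gd => /(_ _ e0'); apply: filterS => x hx.
have -> : complex.Re d - complex.Re (g x) = complex.Re (d - g x).
  by case: (d) => ? ?; case: (g x).
rewrite -ltcR; apply: le_lt_trans hx; exact: normc_ge_Re.
Qed.

Lemma cvg_rc (T : Type) (F : set_system T) {FF : Filter F} (g : T -> R) (a : R) :
  g @ F --> a -> (fun x => rc (g x)) @ F --> (rc a : C).
Proof.
move=> ga; apply/cvgrPdist_lt => e e0.
have e1 : rc (complex.Re e) = e by rewrite RRe_real ?gtr0_real.
have e2 : 0 < complex.Re e by rewrite -ltcR e1.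
move/cvgrPdist_lt: ga => /(_ _ e2); apply: filterS => x hx.
by rewrite -rmorphB normc_def /= expr0n addr0 sqrtr_sqr -e1 ltcR.
Qed.

Lemma is_derive_Re f s d : rderiv f s d ->
  is_derive s 1 (fun x => complex.Re (f x)) (complex.Re d).
Proof.
move=> fd; have := cvg_Re fd.
have -> : (fun h : R => complex.Re ((rc h)^-1 * (f (h + s) - f s))) =
    (fun h => h^-1 *: (((fun x => complex.Re (f x)) \o shift s) (h *: 1) -
                       complex.Re (f s))).
  apply/funext => h /=; rewrite [h *: 1]mulr1 -fmorphV.
  rewrite /GRing.scale /=; case: (f (h + s)) => ? ?; case: (f s) => ? ? /=.
  by rewrite mul0r subr0.
move=> h; split; first by apply/cvg_ex; eexists; exact: h.
by apply/cvg_lim => //; exact: h.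
Qed.

Lemma rderivZ (c : C) f s d : rderiv f s d -> rderiv (fun x => c * f x) s (c * d).
Proof.
move=> fd; rewrite /rderiv.
under eq_fun do rewrite -mulrBr mulrCA.
by apply: cvgM; [exact: cvg_cst | exact: fd].
Qed.

(** The imaginary part of z is the real part of -i z, so statements about real
    parts of complex multiples suffice. *)
Lemma complex_eq_Re (z w : C) : complex.Re z = complex.Re w ->
  complex.Re (- 'i%C * z) = complex.Re (- 'i%C * w) -> z = w.
Proof.
by case: z w => [a b] [a' b'] /= ->; rewrite !oppr0 !mul0r !sub0r !mulN1r !opprK => ->.
Qed.

Lemma rderiv0_cst f : (forall s, rderiv f s 0) -> forall s, f s = f 0.
Proof.
move=> f0 s.
suff H c : complex.Re (c * f s) = complex.Re (c * f 0).
  by apply: complex_eq_Re; last exact: H; rewrite -[f s]mul1r -[f 0]mul1r.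
apply: (@is_derive_0_is_cst R (fun s => complex.Re (c * f s))) => x.
by have := is_derive_Re (@rderivZ c _ _ _ (f0 x)); rewrite mulr0.
Qed.

(** Used to differentiate the complex exponential, whose two components are
    products of real elementary functions. *)
Lemma rderiv_ReIm f s (a b : R) :
  is_derive s 1 (fun x => complex.Re (f x)) a ->
  is_derive s 1 (fun x => complex.Im (f x)) b -> rderiv f s (a +i* b)%C.
Proof.
move=> [fa <-] [fb <-].
have {}fa := cvg_rc (fa : _ --> 'D_1 (fun x => complex.Re (f x)) s).
have {}fb := cvg_rc (fb : _ --> 'D_1 (fun x => complex.Im (f x)) s).
rewrite /rderiv.
have ReIm (x y : R) : (x +i* y)%C = rc x + 'i%C * rc y by rewrite [LHS]complexE.
rewrite ReIm.
have -> : (fun h : R => (rc h)^-1 * (f (h + s) - f s)) = fun h =>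
    rc (h^-1 *: (((fun x => complex.Re (f x)) \o shift s) (h *: 1) -
                 complex.Re (f s))) +
    'i%C * rc (h^-1 *: (((fun x => complex.Im (f x)) \o shift s) (h *: 1) -
                        complex.Im (f s))).
  apply/funext => h /=; rewrite [h *: 1]mulr1 -fmorphV.
  rewrite [LHS]complexE; congr (rc _ + 'i%C * rc _); rewrite /GRing.scale /=;
    by case: (f (h + s)) => ? ?; case: (f s) => ? ? /=; rewrite mul0r ?subr0 ?addr0.
by apply: cvgD; [exact: fa | apply: cvgM; [exact: cvg_cst | exact: fb]].
Qed.

Lemma rderiv_cvg f s d : rderiv f s d -> f (h + s) @[h --> (0 : R)^'] --> f s.
Proof.
move=> fd.
have h0 : (fun h : R => rc h) @ (0 : R)^' --> (rc 0 : C).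
  have : (fun h : R => h) @ (0 : R)^' --> (0 : R).
    by apply: cvg_within_filter; exact: cvg_id.
  exact: cvg_rc.
have : (fun h => f s + rc h * ((rc h)^-1 * (f (h + s) - f s))) @ (0 : R)^' --> f s.
  rewrite -[X in _ --> X]addr0 -(mul0r d).
  by apply: cvgD; [exact: cvg_cst | apply: cvgM; [exact: h0 | exact: fd]].
apply: cvg_trans; apply: near_eq_cvg.
near=> h => /=.
have hn0 : rc h != 0.
  by rewrite eq_complex /= eqxx andbT; near: h; exact: nbhs_dnbhs_neq.
by rewrite mulVKf // addrC subrK.
Unshelve. all: by end_near. Qed.

Lemma rderivM f g s df dg : rderiv f s df -> rderiv g s dg ->
  rderiv (fun x => f x * g x) s (df * g s + f s * dg).
Proof.
move=> fd gd; rewrite /rderiv.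
have : (fun h => ((rc h)^-1 * (f (h + s) - f s)) * g (h + s) +
    f s * ((rc h)^-1 * (g (h + s) - g s))) @ (0 : R)^' --> df * g s + f s * dg.
  apply: cvgD; first by apply: cvgM; [exact: fd | exact: rderiv_cvg gd].
  by apply: cvgM; [exact: cvg_cst | exact: gd].
apply: cvg_trans; apply: near_eq_cvg; near=> h => /=.
rewrite -mulrA [f s * _]mulrCA -mulrDr; congr (_ * _).
by rewrite mulrBl mulrBr subrKA.
Unshelve. all: by end_near. Qed.

Definition cexp (z : R[i]) : R[i] :=
  ((expR (complex.Re z) * cos (complex.Im z)) +i*
   (expR (complex.Re z) * sin (complex.Im z)))%C.

Lemma cexp0 : cexp 0 = 1.
Proof. by rewrite /cexp /= expR0 cos0 sin0 !mul1r. Qed.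

Lemma cexpD z w : cexp (z + w) = cexp z * cexp w.
Proof.
case: z w => [a b] [c d]; rewrite /cexp /= expRD sinD cosD.
by apply/eqP; rewrite eq_complex /=; apply/andP; split; apply/eqP; ring.
Qed.

Lemma cexp_neq0 z : cexp z != 0.
Proof.
apply/eqP => z0; have := cexpD z (- z); rewrite subrr cexp0 z0 mul0r.
by move/eqP; rewrite oner_eq0.
Qed.

Lemma cexpN z : cexp (- z) = (cexp z)^-1.
Proof.
by apply: (mulfI (cexp_neq0 z)); rewrite -cexpD subrr cexp0 mulfV ?cexp_neq0.
Qed.

Lemma cexpMn z n : cexp (z *+ n) = cexp z ^+ n.
Proof.
by elim: n => [|n IH]; rewrite ?mulr0n ?cexp0 // mulrS cexpD IH exprS.
Qed.

Lemma cexpMz z (k : int) : cexp (z *~ k) = cexp z ^ k.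
Proof.
by case: k => n; [exact: cexpMn | rewrite NegzE mulrNz cexpN cexpMn -exprnN].
Qed.

Lemma rderiv_cexp (mu : C) : rderiv (fun s => cexp (rc s * mu)) 0 mu.
Proof.
case: mu => a b.
have Hl (c : R) : is_derive (0 : R) 1 (fun s : R => s * c) c.
  apply: is_derive_eq; rewrite ?[_ *: _]mul0r ?scaler0 ?add0r.
  by rewrite /GRing.scale /= ?mulr1 ?addr0 ?add0r.
have e : is_derive (0 : R) 1 (expR \o (fun s : R => s * a)) a.
  have ? := Hl a.
  by apply: is_derive_eq; rewrite /= mul0r expR0 mul1r.
have c : is_derive (0 : R) 1 (cos \o (fun s : R => s * b)) 0.
  have ? := Hl b.
  by apply: is_derive_eq; rewrite /= mul0r sin0 oppr0 mul0r.
have s : is_derive (0 : R) 1 (sin \o (fun s : R => s * b)) b.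
  have ? := Hl b.
  by apply: is_derive_eq; rewrite /= mul0r cos0 mul1r.
apply: rderiv_ReIm.
- have -> : (fun x => complex.Re (cexp (rc x * (a +i* b)%C))) =
    (expR \o (fun s : R => s * a)) * (cos \o (fun s : R => s * b)).
    by apply/funext => x /=; rewrite !mul0r subr0 addr0.
  by apply: is_derive_eq; rewrite /= !mul0r expR0 cos0 scaler0 add0r scale1r.
- have -> : (fun x => complex.Im (cexp (rc x * (a +i* b)%C))) =
    (expR \o (fun s : R => s * a)) * (sin \o (fun s : R => s * b)).
    by apply/funext => x /=; rewrite !mul0r subr0 addr0.
  by apply: is_derive_eq; rewrite /= !mul0r expR0 sin0 scale0r addr0 scale1r.
Qed.

(** Polar decomposition; the argument is plus or minus an arc cosine according
    to the sign of the imaginary part. *)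
Lemma cexp_surj (t : C) : t != 0 -> exists z, cexp z = t.
Proof.
move=> t0; pose r := Num.sqrt (complex.Re t ^+ 2 + complex.Im t ^+ 2).
have r2 : r ^+ 2 = complex.Re t ^+ 2 + complex.Im t ^+ 2.
  by rewrite sqr_sqrtr // addr_ge0 ?sqr_ge0.
have rt : rc r = `|t| by rewrite normc_def.
have r0 : 0 < r by rewrite -ltcR rt normr_gt0.
have rn0 : r != 0 by rewrite gt_eqF.
pose a := complex.Re t / r; pose b := complex.Im t / r.
have ab : a ^+ 2 + b ^+ 2 = 1.
  by rewrite /a /b !expr_div_n -mulrDl -r2 divff // expf_neq0.
have a1 : -1 <= a <= 1.
  by rewrite -ler_norml -(@expr_le1 _ 2) // real_normK ?num_real // -ab lerDl sqr_ge0.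
have ac : a \in `[(-1), 1] by rewrite in_itv.
have bs : 1 - a ^+ 2 = b ^+ 2 by rewrite -ab addrC addKr.
have lr : expR (ln r) = r by rewrite lnK.
have [b0|b0] := leP 0 b.
- exists (ln r +i* acos a)%C.
  rewrite /cexp /= lr acosK // sin_acos // bs sqrtr_sqr ger0_norm //.
  by rewrite /a /b mulrC divfK // mulrC divfK //; case: (t).
- exists (ln r +i* - acos a)%C.
  rewrite /cexp /= lr cosN sinN acosK // sin_acos // bs sqrtr_sqr ltr0_norm //.
  by rewrite opprK /a /b mulrC divfK // mulrC divfK //; case: (t).
Qed.

Lemma twopii_rect : 2 * rc pi * 'i%C = (0 +i* (pi *+ 2))%C :> R[i].
Proof. by apply/eqP; rewrite eq_complex /=; apply/andP; split; apply/eqP; ring. Qed.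

Lemma cexp_twopii : cexp (2 * rc pi * 'i%C) = 1.
Proof.
by rewrite twopii_rect /cexp /= expR0 !mul1r cos2pi mulr2n sinDpi sinpi oppr0.
Qed.

(** After subtraction of the integer part of Re z one may assume that
    0 <= Re z < 1.  The modulus of exp(2 pi i z) then gives Im z = 0, and its
    real part 1 - 2 sin(pi z)^2 gives sin(pi z) = 0, hence z = 0. *)
Lemma cexp_period (z : C) : cexp (2 * rc pi * 'i%C * z) = 1 ->
  exists k : int, z = k%:~R.
Proof.
pose per (z : C) := cexp (2 * rc pi * 'i%C * z) = 1.
move=> zp.
pose k := Num.floor (complex.Re z); exists k.
have : per (z - k%:~R).
  rewrite /per mulrBr cexpD cexpN zp mulrzr cexpMz.
  by rewrite cexp_twopii exp1rz invr1 mulr1.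
have : 0 <= complex.Re (z - k%:~R) < 1.
  have -> : complex.Re (z - k%:~R) = complex.Re z - k%:~R.
    have -> : k%:~R = rc (k%:~R) by rewrite rmorph_int.
    by case: (z).
  rewrite subr_ge0 ge_floor /=.
  by have := floorD1_gt (complex.Re z); rewrite -/k intrD ltrBlDl.
move=> wx wp; apply/eqP; rewrite -subr_eq0; apply/eqP.
move: (z - k%:~R) wx wp => [x y] /= /andP[x0 x1].
have -> : per (x +i* y)%C = (cexp ((- (pi *+ 2 * y)) +i* (pi * x *+ 2))%C = 1).
  congr (cexp _ = 1).
  by apply/eqP; rewrite eq_complex /=; apply/andP; split; apply/eqP; ring.
rewrite /cexp /= => /eqP; rewrite eq_complex /= => /andP[/eqP ec /eqP es].
have pi0 := pi_gt0 R.
have e1 : expR (- (pi *+ 2 * y)) = 1.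
  have : expR (- (pi *+ 2 * y)) ^+ 2 = 1.
    rewrite -[LHS]mulr1 -(cos2Dsin2 (pi * x *+ 2)) mulrDr -!exprMn ec es.
    by rewrite expr1n expr0n addr0 cos2Dsin2.
  move/eqP; rewrite sqrf_eq1 => /orP[/eqP //|/eqP e].
  by have := expR_gt0 (- (pi *+ 2 * y)); rewrite e oppr_gt0 ltr10.
have y0 : y = 0.
  have := expRK (- (pi *+ 2 * y)); rewrite e1 ln1 => /esym/eqP.
  by rewrite oppr_eq0 mulf_eq0 mulrn_eq0 /= gt_eqF //= => /eqP.
move: ec; rewrite e1 mul1r mulr2n cosD -!expr2 cos2sin2 => c1.
have s0 : sin (pi * x) = 0 by apply/eqP; rewrite -(@sqrf_eq0 R); apply/eqP; lra.
suff -> : x = 0 by rewrite y0.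
apply/eqP; rewrite eq_le x0 andbT leNgt; apply/negP => xp.
have := @sin_gt0_pi R (pi * x); rewrite s0 ltxx => H.
by have : false by apply: H; rewrite mulr_gt0 //= gtr_pMr.
Qed.

End RealParameter.

(** * The differential of a holomorphic representation *)

Section CoordinateFunctionals.
Variables (R : realType) (g : vectType R[i]) (n : nat) (b : n.-tuple g).

(** Coordinates as elements of Hom(g, C), the form in which functionals test
    the derivatives of the representation. *)
Definition coordf (i : 'I_n) : 'Hom(g, R[i]^o) := linfun (coord b i : g -> R[i]^o).

Lemma coordfE i x : coordf i x = coord b i x.
Proof. by rewrite lfunE. Qed.

Lemma functionalZ (l : 'Hom(g, R[i]^o)) (a : R[i]) x : l (a *: x) = a * l x.
Proof. exact: linearZ. Qed.

Lemma functionalD (l : 'Hom(g, R[i]^o)) x y : l (x + y) = l x + l y :> R[i].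
Proof. exact: (linearD l). Qed.

Lemma functionalB (l : 'Hom(g, R[i]^o)) x y : l (x - y) = l x - l y :> R[i].
Proof. exact: (linearB l). Qed.

Lemma functional_coord (l : 'Hom(g, R[i]^o)) x : basis_of {:g} b ->
  l x = \sum_(i < n) coord b i x * l b`_i :> R[i].
Proof.
move=> bb; rewrite {1}(coord_basis bb (memvf x)) linear_sum.
by apply: eq_bigr => i _; exact: functionalZ.
Qed.

End CoordinateFunctionals.

Section Differential.
Variables (R : realType) (g : vectType R[i]) (br : g -> g -> g).
Variable rho : 'M[R[i]]_2 -> 'End(g).
Hypothesis Hrho : lie_aut_rep br rho.
Local Notation C := (R[i] : numFieldType).

Definition holomorphic_extension (F : 'M[R[i]]_2 -> 'End(g)) : Prop :=
  \forall B \near (1%:M : 'M[C]_2), (\det B = 1 -> F B = rho B) /\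
    forall (x : g) (l : 'Hom(g, R[i]^o)),
      differentiable (fun A' : 'M[C]_2 => l (F A' x)) (B : 'M[C]_2).

Lemma exists_holomorphic_extension : exists F, holomorphic_extension F.
Proof. by apply: (rep_holomorphic Hrho); rewrite det1. Qed.

(** Near t = 0 the curve stays in the domain of F and in SL(2), so that rho may
    be replaced by F and the chain rule applies. *)
Lemma is_derive_rho_curve F (X : 'M[C]_2) (c : C -> 'M[C]_2) (x : g)
    (l : 'Hom(g, R[i]^o)) :
  holomorphic_extension F ->
  c 0 = 1%:M -> (\forall t \near (0 : C), \det (c t) = 1) ->
  is_derive (0 : C) (1 : C) c X ->
  is_derive (0 : C) (1 : C) (fun t => l (rho (c t) x))
    ('D_X (fun A' : 'M[C]_2 => l (F A' x)) (1%:M : 'M[C]_2)).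
Proof.
move=> HF c0 detc [dc cX].
have cdiff : differentiable c (0 : C) by apply/derivable1_diffP.
have Fdiff : differentiable (fun A' : 'M[C]_2 => l (F A' x)) (c 0).
  by have [_] := nbhs_singleton HF; rewrite c0; exact.
have ccont := differentiable_continuous cdiff.
have : is_derive (0 : C) (1 : C) ((fun A' : 'M[C]_2 => l (F A' x)) \o c)
    ('D_X (fun A' : 'M[C]_2 => l (F A' x)) (1%:M : 'M[C]_2)).
  split; first by apply/derivable1_diffP; exact: differentiable_comp.
  rewrite deriveE; last exact: differentiable_comp.
  rewrite diff_comp // -c0 deriveE //=; congr ('d _ _ _).
  by rewrite -cX deriveE.
apply: near_eq_is_derive.
have : \forall B \near c 0, \det B = 1 -> l (F B x) = l (rho B x).
  by rewrite c0; apply: filterS HF => B [FB _] /FB ->.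
by move/ccont; apply: filterS2 detc => t d1; apply.
Qed.

(** The derivative of F at the identity in the direction X is computed in
    coordinates; it is linear in the vector because F takes linear values. *)
Lemma drhoP (X : 'M[R[i]]_2) : is_drho rho X (drho rho X).
Proof.
have [F HF] := exists_holomorphic_extension.
rewrite /drho; apply: xgetPex.
pose lc := coordf (vbasis {:g}).
have Fd (x : g) (l : 'Hom(g, R[i]^o)) :
    derivable (fun A' : 'M[C]_2 => l (F A' x)) (1%:M : 'M[C]_2) X.
  by apply: diff_derivable; have [_] := nbhs_singleton HF; exact.
pose D0 x := \sum_(i < \dim {:g})
  ('D_X (fun A' : 'M[C]_2 => lc i (F A' x)) (1%:M : 'M[C]_2) : R[i]) *:
    (vbasis {:g})`_i.
have D0l : linear D0.
  move=> a x y; rewrite /D0 scaler_sumr -big_split /=; apply: eq_bigr => i _.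
  rewrite scalerA -scalerDl; congr (_ *: _).
  have -> : (fun A' : 'M[C]_2 => lc i (F A' (a *: x + y))) =
      a *: (fun A' : 'M[C]_2 => lc i (F A' x)) +
      (fun A' : 'M[C]_2 => lc i (F A' y)).
    by apply/funext => A; rewrite (linearP (F A)); exact: (linearP (lc i)).
  by rewrite (deriveD (derivableZ (k := a) (Fd x (lc i))) (Fd y (lc i)))
    (deriveZ a (Fd x (lc i))).
pose D1 : {linear g -> g} := HB.pack D0 (GRing.isLinear.Build _ _ _ _ D0 D0l).
exists (linfun D1) => c c0 detc dc x l.
have := is_derive_rho_curve x l HF c0 detc dc.
suff -> : l (linfun D1 x) =
    'D_X (fun A' : 'M[C]_2 => l (F A' x)) (1%:M : 'M[C]_2) by [].
rewrite lfunE /= /D0 linear_sum /=.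
have -> : (fun A' : 'M[C]_2 => l (F A' x)) =
   \sum_(i < \dim {:g}) (l (vbasis {:g})`_i *: (fun A' : 'M[C]_2 => lc i (F A' x))).
  apply/funext => A; rewrite fct_sumE {1}(coord_vbasis (memvf (F A x))) linear_sum.
  apply: eq_bigr => i _; rewrite linearZ.
  by rewrite -coordfE [LHS]mulrC.
rewrite derive_sum; last by move=> i; apply: derivableZ.
apply: eq_bigr => i _; rewrite (deriveZ _ (Fd x (lc i))) linearZ /=; exact: mulrC.
Qed.

End Differential.

(** * The action of the maximal torus *)

Section Mat2.
Variable K : comPzRingType.

Lemma mat2_mul (a b c d a' b' c' d' : K) :
  mat2 a b c d *m mat2 a' b' c' d' =
  mat2 (a * a' + b * c') (a * b' + b * d') (c * a' + d * c') (c * b' + d * d').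
Proof.
by apply/matrixP => i j; rewrite !mxE !big_ord_recl big_ord0 !mxE addr0;
  case: i => [[|[|?]]] // ?; case: j => [[|[|?]]].
Qed.

Lemma mat2_1 : mat2 1 0 0 1 = 1%:M :> 'M[K]_2.
Proof.
by apply/matrixP => i j; rewrite !mxE; case: i => [[|[|?]]] // ?; case: j => [[|[|?]]].
Qed.

Lemma mat2_eta (A : 'M[K]_2) :
  A = mat2 (A ord0 ord0) (A ord0 ord_max) (A ord_max ord0) (A ord_max ord_max).
Proof.
apply/matrixP => i j; rewrite !mxE.
by case: i => [[|[|?]]] // ?; case: j => [[|[|?]]] // ? /=; congr (A _ _); apply/val_inj.
Qed.

Lemma det_mat2 (a b c d : K) : \det (mat2 a b c d) = a * d - b * c.
Proof.
rewrite (expand_det_row _ ord0) !big_ord_recl big_ord0 /cofactor !det_mx11 !mxE /=.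
by rewrite addr0 expr0 expr1 !mul1r mulN1r mulrN.
Qed.

End Mat2.

Definition torus (K : fieldType) (t : K) : 'M[K]_2 := mat2 t 0 0 t^-1.

Lemma det_torus (K : fieldType) (t : K) : t != 0 -> \det (torus t) = 1.
Proof. by move=> t0; rewrite det_mat2 mulr0 subr0 mulfV. Qed.

Lemma torus1 (K : fieldType) : torus 1 = 1%:M :> 'M[K]_2.
Proof. by rewrite /torus invr1 mat2_1. Qed.

Lemma torusM (K : fieldType) (s t : K) : torus (s * t) = torus s *m torus t.
Proof. by rewrite mat2_mul !mulr0 !mul0r !addr0 !add0r -invfM mulrC. Qed.

Section Chain.
Variable R : realType.
Local Notation C := (R[i] : numFieldType).
Local Notation rc := (real_complex R : R -> C).

Lemma is_derive_scalel (k : C -> C) dk (A : 'M[C]_2) :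
  is_derive (0 : C) (1 : C) k dk ->
  is_derive (0 : C) (1 : C) (fun t => k t *: A) (dk *: A).
Proof.
move=> [/derivable1_diffP kd <-]; split.
  by apply/derivable1_diffP; exact: differentiableZl.
by rewrite deriveE ?diffZl -?deriveE //; exact: differentiableZl.
Qed.

Lemma is_derive_torus :
  is_derive (0 : C) (1 : C) (fun t : C => torus (1 + t) : 'M[C]_2) (mat2 1 0 0 (-1)).
Proof.
have -> : (fun t : C => torus (1 + t) : 'M[C]_2) =
    (fun t => (1 + t) *: mat2 1 0 0 0) + (fun t => (1 + t)^-1 *: mat2 0 0 0 1).
  apply/funext => t; apply/matrixP => i j; rewrite !mxE.
  by case: i => [[|[|?]]] // ?; case: j => [[|[|?]]] // ? /=;
    rewrite ?mulr1 ?mulr0 ?addr0 ?add0r.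
have -> : mat2 1 0 0 (-1) = 1 *: mat2 1 0 0 0 + (-1) *: mat2 0 0 0 1 :> 'M[C]_2.
  apply/matrixP => i j; rewrite !mxE.
  by case: i => [[|[|?]]] // ?; case: j => [[|[|?]]] // ? /=;
    rewrite ?mulr1 ?mulr0 ?addr0 ?add0r.
have d1 : is_derive (0 : C) (1 : C) (fun t : C => 1 + t) 1.
  have -> : (fun t : C => 1 + t) = cst 1 + id by [].
  rewrite -[X in is_derive _ _ _ X](add0r (1 : C)).
  by apply: is_deriveD.
apply: is_deriveD; apply: is_derive_scalel => //.
have n0 : (fun t : C => 1 + t) 0 != 0 by rewrite addr0 oner_neq0.
case: d1 => dd dv; split; first exact: derivableV.
by rewrite deriveV // dv addr0 expr1n invr1 [LHS]mulr1.
Qed.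

(** Chain rule for a holomorphic function after a real curve.  The difference
    quotient q of f, completed by its limit a at 0, is continuous at 0; unlike
    the raw quotient it may be composed with w even where w vanishes. *)
Lemma rderiv_comp (f : C -> C) (w : R -> C) (a mu : C) :
  is_derive (0 : C) (1 : C) f a -> rderiv w 0 mu -> w 0 = 0 ->
  rderiv (fun s => f (w s)) 0 (mu * a).
Proof.
move=> [fd fa] wd w0.
pose q (z : C) : C := if z == 0 then a else z^-1 * (f z - f 0).
have qa : q @ (0 : C) --> a.
  have q0 : q 0 = a by rewrite /q eqxx.
  rewrite -[X in _ --> X]q0; apply/continuous_withinNx; rewrite q0 -fa.
  apply: cvg_trans fd; apply: near_eq_cvg; near=> h.
  have hn0 : h != 0 by near: h; exact: nbhs_dnbhs_neq.
  by rewrite /q (negPf hn0) /= [h *: 1]mulr1 addr0.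
have qw : (fun h => q (w (h + 0))) @ (0 : R)^' --> a.
  by apply: (cvg_comp _ _ _ qa); rewrite -w0; exact: rderiv_cvg wd.
rewrite /rderiv.
have -> : (fun h : R => (rc h)^-1 * (f (w (h + 0)) - f (w 0))) =
   (fun h => ((rc h)^-1 * (w (h + 0) - w 0)) * q (w (h + 0))).
  apply/funext => h; rewrite w0 subr0 /q; case: eqVneq => [->|wn0].
    by rewrite subrr mulr0 mul0r.
  by rewrite -mulrA mulVKf.
by apply: cvgM; [exact: wd | exact: qw].
Unshelve. all: by end_near. Qed.

End Chain.

Section OneParameter.
Variables (R : realType) (g : vectType R[i]).
Local Notation C := (R[i] : numFieldType).
Local Notation rc := (real_complex R : R -> C).

Lemma functionals_separate (x y : g) :
  (forall l : 'Hom(g, R[i]^o), l x = l y) -> x = y.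
Proof.
move=> H; rewrite (coord_vbasis (memvf x)) (coord_vbasis (memvf y)).
by apply: eq_bigr => i _; rewrite -!coordfE H.
Qed.

(** The function l (W s x) - s l z has derivative l (W s z) - l z = 0 at every
    s: by the group law, its derivative at s is the derivative at 0 for the
    functional l o W s. *)
Lemma one_parameter_orbit (W : R -> 'End(g)) (x z : g) :
  W 0 = \1%VF -> (forall s t, W (s + t) = (W s \o W t)%VF) ->
  (forall l : 'Hom(g, R[i]^o), rderiv (fun s => l (W s x)) 0 (l z)) ->
  (forall s, W s z = z) ->
  forall s, W s x = x + rc s *: z.
Proof.
move=> W0 WD Wx Wz s; apply: functionals_separate => l.
pose f (s : R) : C := l (W s x) - rc s * l z.
suff H : f s = f 0.
  move: H; rewrite /f W0 id_lfunE mul0r subr0 => /eqP.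
  by rewrite subr_eq => /eqP ->; rewrite linearD linearZ.
apply: rderiv0_cst => {}s; rewrite /rderiv.
have : (fun h : R => (rc h)^-1 * (l (W (h + s) x) - l (W s x))) @ (0 : R)^' --> (l z : C).
  have := Wx (l \o W s)%VF; rewrite /rderiv [(l \o W s)%VF z]comp_lfunE Wz.
  apply: cvg_trans; apply: near_eq_cvg; near=> h.
  by rewrite addr0 W0 [h + s]addrC WD !comp_lfunE id_lfunE.
move=> H.
have : (fun h : R => (rc h)^-1 * (l (W (h + s) x) - l (W s x)) - l z)
    @ (0 : R)^' --> (0 : C).
  by rewrite -(subrr (l z : C)); apply: cvgB; [exact: H | exact: cvg_cst].
apply: cvg_trans; apply: near_eq_cvg; near=> h.
have hn0 : rc h != 0.
  by rewrite eq_complex /= eqxx andbT; near: h; exact: nbhs_dnbhs_neq.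
rewrite /f /= -[l z in LHS](mulKf hn0) -mulrBr; congr (_ * _).
have -> : rc (h + s) = rc h + rc s by exact: rmorphD.
by ring.
Unshelve. all: by end_near. Qed.

End OneParameter.

Section Torus.
Variables (R : realType) (g : vectType R[i]) (br : g -> g -> g).
Variable rho : 'M[R[i]]_2 -> 'End(g).
Hypothesis Hrho : lie_aut_rep br rho.
Local Notation C := (R[i] : numFieldType).
Local Notation rc := (real_complex R : R -> C).
Local Notation H := (drho rho (mat2 1 0 0 (-1))).
Local Notation T t := (rho (torus t)).

Lemma rho_torusM (s t : R[i]) : s != 0 -> t != 0 -> T (s * t) = (T s \o T t)%VF.
Proof. by move=> s0 t0; rewrite torusM (repM Hrho) ?det_torus. Qed.

Lemma rho_torus1 : T 1 = \1%VF.
Proof. by rewrite torus1 (rep1 Hrho). Qed.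

(** The holomorphic curve diag(1 + t, 1 / (1 + t)), reparametrized by
    t = exp(s mu) - 1. *)
Lemma rderiv_rho_torus (x : g) (l : 'Hom(g, R[i]^o)) (mu : R[i]) :
  rderiv (fun s => l (T (cexp (rc s * mu)) x)) 0 (mu * l (H x)).
Proof.
pose f (t : C) : C := l (T (1 + t) x).
pose w (s : R) : C := cexp (rc s * mu) - 1.
have w0 : w 0 = 0 by rewrite /w mul0r cexp0 subrr.
have wd : rderiv w 0 mu.
  have := @rderiv_cexp R mu; rewrite /rderiv /w.
  by under [in X in _ -> X]eq_fun do rewrite opprB addrA subrK.
have fd : is_derive (0 : C) (1 : C) f (l (H x)).
  apply: (drhoP Hrho); last exact: is_derive_torus.
    by rewrite addr0 torus1.
  have t1 : \forall t \near (0 : C), `|t| < 1.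
    by apply: (@pseudometric_normed_Zmodule.nbhs0_lt C C 1).
  apply: filterS t1 => t t1; rewrite det_torus //.
  apply: contraTneq t1 => /eqP; rewrite addrC addr_eq0 => /eqP ->.
  by rewrite normrN1 ltxx.
have -> : (fun s => l (T (cexp (rc s * mu)) x)) = (fun s => f (w s)).
  by apply/funext => s; rewrite /f /w subrKC.
exact: rderiv_comp fd wd w0.
Qed.

(** The exponential of mu H on a Jordan block of size two: after division by
    exp(s mu lam), the one-parameter group s |-> T (exp(s mu)) fixes y and has
    velocity mu y at x. *)
Lemma rho_torus_exp (lam mu : R[i]) (x y : g) :
  H x = lam *: x + y -> H y = lam *: y ->
  T (cexp mu) x = cexp (mu * lam) *: (x + mu *: y).
Proof.
move=> Hx Hy.
pose W (s : R) : 'End(g) := cexp (rc s * (- (mu * lam))) *: T (cexp (rc s * mu)).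
have W0 : W 0 = \1%VF by rewrite /W !mul0r cexp0 scale1r rho_torus1.
have WD s t : W (s + t) = (W s \o W t)%VF.
  have rD : rc (s + t) = rc s + rc t by exact: rmorphD.
  rewrite /W rD !mulrDl !cexpD rho_torusM ?cexp_neq0 //.
  apply/lfunP => v; rewrite !(comp_lfunE, scale_lfunE).
  by rewrite [X in _ = _ *: X]linearZ scalerA.
have Wd (v : g) (l : 'Hom(g, R[i]^o)) :
    rderiv (fun s => l (W s v)) 0 (l (mu *: (H v - lam *: v))).
  have := rderivM (@rderiv_cexp R (- (mu * lam))) (@rderiv_rho_torus v l mu).
  rewrite !mul0r cexp0 rho_torus1 id_lfunE mul1r.
  have -> : l (mu *: (H v - lam *: v)) = - (mu * lam) * l v + mu * l (H v).
    by rewrite functionalZ functionalB functionalZ; ring.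
  rewrite /rderiv /W.
  by under [in X in _ -> X]eq_fun do rewrite !scale_lfunE !functionalZ.
have Wy s : W s y = y.
  rewrite (@one_parameter_orbit _ _ W y 0) ?scaler0 ?addr0 // => [l|t].
    by have := Wd y l; rewrite Hy subrr scaler0.
  by rewrite linear0.
have Wx : W 1 x = x + mu *: y.
  rewrite (@one_parameter_orbit _ _ W x (mu *: y)) // => [|l|t].
  - by rewrite [rc 1]rmorph1 scale1r.
  - by have := Wd x l; rewrite Hx addrC addKr.
  - by rewrite linearZ /= Wy.
by rewrite -Wx /W !mul1r scale_lfunE scalerA cexpN mulfV ?cexp_neq0 // scale1r.
Qed.

End Torus.

(** * Weight spaces *)

Lemma free_subseq_span (K : fieldType) (V : vectType K) (s : seq V) :
  exists s' : seq V, [/\ {subset s' <= s}, free s' & (<<s'>> = <<s>>)%VS].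
Proof.
elim: s => [|x s [s' [ss fs' es']]]; first by exists [::]; rewrite nil_free.
have [xs|xs] := boolP (x \in <<s'>>%VS).
  exists s'; split => // [y /ss|]; first by rewrite inE orbC => ->.
  by rewrite span_cons -es'; apply/esym/addv_idPr; rewrite -memvE.
exists (x :: s'); split; last by rewrite !span_cons es'.
- move=> y; rewrite !inE => /orP[->//|/ss ->]; exact: orbT.
- by rewrite free_cons xs.
Qed.

Section Krylov.
Variables (K : closedFieldType) (V : vectType K) (H : 'End(V)).

(** The value at x of the product of the commuting operators H - a, for a in
    s. *)
Definition apply_factors (s : seq K) (x : V) : V := foldl (fun y a => H y - a *: y) x s.

(** p(H) x, where n bounds the size of p. *)
Let ev n (p : {poly K}) x := \sum_(i < n) p`_i *: iter i H x.

Let ev_XsubC n (p : {poly K}) a x : (size p <= n)%N ->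
  ev n.+1 (('X - a%:P) * p) x = ev n p (H x - a *: x).
Proof.
move=> pn.
have iterB i : iter i H (H x - a *: x) = iter i.+1 H x - a *: iter i H x.
  by elim: i => //= i ->; rewrite linearB linearZ.
have E : ev n p (H x - a *: x) =
    \sum_(i < n) p`_i *: iter i.+1 H x - \sum_(i < n) (a * p`_i) *: iter i H x.
  rewrite -sumrB; apply: eq_bigr => i _.
  by rewrite iterB scalerBr scalerA [a * _]mulrC.
have E2 : \sum_(i < n) (a * p`_i) *: iter i H x =
    \sum_(i < n.+1) (a * p`_i) *: iter i H x.
  by rewrite big_ord_recr /= (nth_default _ pn) mulr0 scale0r addr0.
have E1 : \sum_(i < n) p`_i *: iter i.+1 H x =
    \sum_(i < n.+1) ('X * p)`_i *: iter i H x.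
  rewrite big_ord_recl coefXM eqxx scale0r add0r.
  by apply: eq_bigr => i _; rewrite coefXM.
rewrite E E1 E2 -sumrB; apply: eq_bigr => i _.
by rewrite mulrBl coefB coefCM scalerBl.
Qed.

Let ev_prod r n x : (size r < n)%N ->
  ev n (\prod_(z <- r) ('X - z%:P)) x = apply_factors r x.
Proof.
elim: r n x => [|a r IH] [|n] x //=.
  move=> _; rewrite big_nil /ev big_ord_recl coefC eqxx scale1r big1 ?addr0 //.
  by move=> i _; rewrite coefC /= scale0r.
by move=> rn; rewrite big_cons ev_XsubC ?IH // size_prod_XsubC.
Qed.

(** The vectors x, H x, ..., H^n x are linearly dependent when n is the
    dimension, and the resulting polynomial in H splits into linear factors. *)
Lemma exists_annihilating_factors x : exists s, apply_factors s x = 0.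
Proof.
set n := \dim {:V}.
pose v := [tuple iter i H x | i < n.+1].
have : ~~ free v.
  apply/negP; rewrite /free size_tuple => /eqP e.
  by have := dimvS (subvf <<v>>%VS); rewrite e ltnn.
move=> /freeP nf.
have [c [c0 [i ci]]] : exists c : 'I_n.+1 -> K,
    \sum_(i < n.+1) c i *: v`_i = 0 /\ exists i, c i != 0.
  apply: contrapT => nc; apply: nf => c c0 i; apply/eqP; apply: contrapT => ci.
  by apply: nc; exists c; split => //; exists i; apply/negP.
pose p : {poly K} := \poly_(i < n.+1) (if insub i is Some j then c j else 0).
have pc (j : 'I_n.+1) : p`_j = c j by rewrite coef_poly ltn_ord valK.
have p0 : p != 0.
  by apply: contraNneq ci => p0; rewrite -pc p0 coef0.
have evp : ev n.+1 p x = 0.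
  rewrite -[RHS]c0; apply: eq_bigr => j _; rewrite pc.
  by rewrite (_ : v`_j = iter j H x) // -tnth_nth tnth_mktuple.
have [r pr] := closed_field_poly_normal p; exists r.
have sr : (size r < n.+1)%N.
  have := size_poly n.+1 (fun i => if insub i is Some j then c j else 0).
  by rewrite -/p pr size_scale ?lead_coef_eq0 // size_prod_XsubC.
have lc0 : lead_coef p != 0 by rewrite lead_coef_eq0.
rewrite -(ev_prod _ sr); apply: (scalerI lc0); rewrite scaler0 -[RHS]evp.
rewrite [in RHS]pr /ev scaler_sumr; apply: eq_bigr => j _.
by rewrite coefZ scalerA.
Qed.

End Krylov.

Section Weights.
Variables (R : realType) (g : vectType R[i]) (br : g -> g -> g).
Variable rho : 'M[R[i]]_2 -> 'End(g).
Hypothesis Hrho : lie_aut_rep br rho.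
Local Notation rc := (real_complex R).
Local Notation H := (drho rho (mat2 1 0 0 (-1))).
Local Notation T t := (rho (torus t)).

Lemma weight_spaceP (k : int) x :
  reflect (H x = k%:~R *: x) (x \in weight_space rho k).
Proof.
rewrite /weight_space /passmx.leigenspace memv_ker add_lfunE opp_lfunE.
by rewrite scale_lfunE id_lfunE subr_eq0; exact: eqP.
Qed.

Let twopii : R[i] := 2 * rc pi * 'i%C.

(** T (exp(2 pi i)) = T 1 is the identity but acts on an eigenvector as
    exp(2 pi i a). *)
Lemma eigenvalue_int (a : R[i]) x : x != 0 -> H x = a *: x ->
  exists k : int, a = k%:~R.
Proof.
move=> x0 Hx; apply: cexp_period; apply/eqP; rewrite -subr_eq0.
have := @rho_torus_exp _ _ _ _ Hrho a twopii x 0.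
rewrite addr0 linear0 scaler0 => /(_ Hx erefl).
rewrite cexp_twopii (rho_torus1 Hrho) id_lfunE scaler0 addr0 => /eqP.
rewrite eq_sym -subr_eq0 -{2}[x]scale1r -scalerBl scaler_eq0.
by rewrite (negPf x0) orbF.
Qed.

(** T (exp(2 pi i)) = T 1 is the identity but maps x to x + 2 pi i y. *)
Lemma no_jordan_block (a : R[i]) x y : H x = a *: x + y -> H y = a *: y -> y = 0.
Proof.
move=> Hx Hy; have [//|y0] := eqVneq y 0.
have [k ak] := eigenvalue_int y0 Hy.
have := @rho_torus_exp _ _ _ _ Hrho a twopii x y Hx Hy.
rewrite cexp_twopii (rho_torus1 Hrho) id_lfunE ak mulrzr cexpMz cexp_twopii.
rewrite exp1rz scale1r => /eqP; rewrite -subr_eq0 opprD addNKr oppr_eq0 scaler_eq0.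
have t0 : twopii != 0.
  by rewrite /twopii twopii_rect eq_complex /= eqxx mulrn_eq0 /= gt_eqF // pi_gt0.
by rewrite (negPf t0) => /eqP.
Qed.

Lemma rho_torus_weight (k : int) x t : t != 0 -> x \in weight_space rho k ->
  T t x = t ^ k *: x.
Proof.
move=> t0 /weight_spaceP Hx.
have [mu <-] := cexp_surj t0.
rewrite (@rho_torus_exp _ _ _ _ Hrho k%:~R mu x 0) ?addr0 ?linear0 ?scaler0 //.
by rewrite addr0 mulrzr cexpMz.
Qed.

Let weight_vectors (s : seq g) : Prop :=
  forall v, v \in s -> exists k : int, v \in weight_space rho k.

(** Induction on a product of factors H - a killing x.  The vector H x - a x is
    a sum of weight vectors; those of weight different from a are in the image
    of H - a on weight vectors, so that x can be corrected until H x - a x is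
    itself killed by H - a.  It then vanishes, as there is no Jordan block. *)
Let sum_weight_vectors x :
  exists2 s, weight_vectors s & x = \sum_(v <- s) v.
Proof.
have [r] := exists_annihilating_factors H x.
elim: r x => [|a r IH] x /=; first by move=> ->; exists [::]; rewrite ?big_nil.
move/IH => [s sw Hx].
have [x' [z [[s' s'w x'E] Hz E]]] : exists x' z,
    [/\ exists2 s', weight_vectors s' & x' = \sum_(v <- s') v,
     H z = a *: z & \sum_(v <- s) v = H x' - a *: x' + z].
  elim: s sw {Hx} => [|v s IHs] sw.
    exists 0, 0; split; rewrite ?big_nil ?linear0 ?scaler0 ?subrr ?addr0 //.
    by exists [::]; rewrite ?big_nil.
  have [|x' [z [[s' s'w ->] Hz E]]] := IHs.
    by move=> w ws; apply: sw; rewrite inE ws orbT.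
  have [k /weight_spaceP vk] := sw v (mem_head _ _).
  have [ka|ka] := eqVneq k%:~R a.
    exists (\sum_(v <- s') v), (z + v); split; first by exists s'.
      by rewrite linearD /= Hz vk ka scalerDr.
    by rewrite big_cons E addrCA [v + z]addrC.
  pose v' := (k%:~R - a)^-1 *: v.
  have Hv' : H v' = k%:~R *: v' by rewrite /v' linearZ /= vk !scalerA mulrC.
  exists (v' + \sum_(v <- s') v), z; split => //.
    exists (v' :: s'); rewrite ?big_cons // => w; rewrite inE => /orP[/eqP ->|/s'w //].
    by exists k; apply/weight_spaceP.
  rewrite big_cons E linearD /= scalerDr opprD [in RHS]addrACA Hv' -scalerBl.
  rewrite /v' scalerA mulfV ?subr_eq0 // scale1r; exact: addrA.
have Hxx : H (x - x') = a *: (x - x') + z.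
  rewrite linearB scalerBr /=; move: E => /eqP; rewrite -Hx subr_eq => /eqP ->.
  by rewrite -!addrA [H x' + _]addrC -!addrA addNr addr0 addrA addrC.
have z0 := no_jordan_block Hxx Hz.
move: Hxx; rewrite z0 addr0 => Hxx.
exists (x - x' :: s'); last by rewrite big_cons -x'E subrK.
move=> w; rewrite inE => /orP[/eqP ->|/s'w //].
have [->|n0] := eqVneq (x - x') 0; first by exists 0; rewrite mem0v.
have [k ak] := eigenvalue_int n0 Hxx.
by exists k; apply/weight_spaceP; rewrite -ak.
Qed.

Lemma weight_basis : exists n (e : n.-tuple g) (k : 'I_n -> int),
  basis_of {:g} e /\ forall i : 'I_n, e`_i \in weight_space rho (k i).
Proof.
have [s sw sf] : exists2 s, weight_vectors s & (<<s>> = {:g})%VS.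
  have [s sw sb] : exists2 s, weight_vectors s & {subset tval (vbasis {:g}) <= <<s>>%VS}.
    elim: (tval (vbasis {:g})) => [|x b [s sw sb]]; first by exists [::].
    have [s' s'w xs'] := sum_weight_vectors x.
    exists (s' ++ s) => [v|v]; first by rewrite mem_cat => /orP[/s'w|/sw].
    rewrite inE span_cat => /orP[/eqP ->|/sb vs].
      rewrite xs' big_seq; apply: (subvP (addvSl _ _)).
      by apply: memv_suml => w ws; exact: memv_span.
    by apply: (subvP (addvSr _ _)).
  exists s => //; apply/eqP; rewrite eqEsubv subvf /=.
  by rewrite -(span_basis (vbasisP {:g})); apply/span_subvP.
have [s' [ss fs es]] := free_subseq_span s.
have ek (i : 'I_(size s')) : exists k : int, s'`_i \in weight_space rho k.
  by apply: sw; apply: ss; exact: mem_nth.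
exists (size s'), (in_tuple s'), (fun i => xchoose (ek i)); split.
  by rewrite basisEfree fs es sf subvf /= -sf -es (eqnP fs).
by move=> i; exact: (xchooseP (ek i)).
Qed.

Lemma coord_rho_torus n (e : n.-tuple g) (k : 'I_n -> int) i t x :
  basis_of {:g} e -> (forall i : 'I_n, e`_i \in weight_space rho (k i)) ->
  t != 0 -> coord e i (T t x) = t ^ k i * coord e i x.
Proof.
move=> eb ew t0.
rewrite {1}(coord_basis eb (memvf x)) linear_sum.
under eq_bigr => j _ do
  rewrite linearZ /= (rho_torus_weight t0 (ew j)) scalerA.
rewrite coord_sum_free ?(basis_free eb) //; exact: mulrC.
Qed.

End Weights.

(** * Algebras of functions and their localizations *)

Section FunctionAlgebras.
Variables (K : fieldType) (U : Type).
Implicit Types (A : set (U -> K)) (f h : U -> K).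

Record fun_algebra A : Prop := FunAlgebra {
  fa_cst : forall c, A (fun=> c);
  fa_add : forall f h, A f -> A h -> A (fun u => f u + h u);
  fa_mul : forall f h, A f -> A h -> A (fun u => f u * h u)
}.

Section Closure.
Variables (A : set (U -> K)) (HA : fun_algebra A).

Lemma fa_opp f : A f -> A (fun u => - f u).
Proof.
move=> Af; rewrite (_ : (fun u => _) = (fun u => -1 * f u)).
  exact: fa_mul (fa_cst HA _) Af.
by apply/funext => u; rewrite mulN1r.
Qed.

Lemma fa_sum n (F : 'I_n -> U -> K) :
  (forall i, A (F i)) -> A (fun u => \sum_(i < n) F i u).
Proof.
elim: n F => [|n IH] F AF.
  rewrite (_ : (fun u => _) = (fun=> 0)); first exact: fa_cst.
  by apply/funext => u; rewrite big_ord0.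
rewrite (_ : (fun u => _) =
    (fun u => F ord0 u + \sum_(i < n) F (lift ord0 i) u)); last first.
  by apply/funext => u; rewrite big_ord_recl.
by apply: fa_add => //; apply: IH.
Qed.

Lemma fa_exp f n : A f -> A (fun u => f u ^+ n).
Proof.
move=> Af; elim: n => [|n IH]; first exact: fa_cst.
rewrite (_ : (fun u => _) = (fun u => f u * f u ^+ n)); first exact: fa_mul.
by apply/funext => u; rewrite exprS.
Qed.

Lemma fa_exprz f (k : int) :
  A f -> A (fun u => (f u)^-1) -> A (fun u => f u ^ k).
Proof.
case: k => n Af Afi; first exact: fa_exp.
rewrite (_ : (fun u => _) = (fun u => (f u)^-1 ^+ n.+1)); first exact: fa_exp.
by apply/funext => u; rewrite NegzE -exprnN exprVn.
Qed.

Lemma fa_horner (p : {poly K}) f : A f -> A (fun u => p.[f u]).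
Proof.
move=> Af; rewrite (_ : (fun u => _) = (fun u => \sum_(i < size p) p`_i * f u ^+ i)).
  by apply: fa_sum => i; apply: fa_mul (fa_cst HA _) (fa_exp _ Af).
by apply/funext => u; rewrite horner_coef.
Qed.

End Closure.

(** The analogue of A[1/d] for functions defined on all of U: multiplication by
    a large power of d also erases the values at the zeros of d, so that a
    function is only tested where d does not vanish ([localized_eq]). *)
Definition localized A (d : U -> K) : set (U -> K) :=
  [set f | exists N, forall n, (N <= n)%N -> A (fun u => d u ^+ n * f u)].

Section Localization.
Variables (A : set (U -> K)) (HA : fun_algebra A) (d : U -> K) (Ad : A d).

Lemma sub_localized f : A f -> localized A d f.
Proof. by move=> Af; exists 0 => n _; apply: fa_mul => //; exact: fa_exp. Qed.

Lemma localized_inv : localized A d (fun u => (d u)^-1).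
Proof.
(* The exponent 2 leaves a positive power of d, so both sides vanish with d. *)
exists 2 => -[|[|n]] // _.
rewrite (_ : (fun u => _) = (fun u => d u ^+ n.+1)); first exact: fa_exp.
apply/funext => u; rewrite exprSr; have [->|d0] := eqVneq (d u) 0.
  by rewrite expr0n mul0r mul0r.
by rewrite mulfK.
Qed.

Lemma localized_algebra : fun_algebra (localized A d).
Proof.
split.
- by move=> c; apply: sub_localized; exact: fa_cst.
- move=> f h [N fN] [M hM]; exists (N + M)%N => n NMn.
  rewrite (_ : (fun u => _) = (fun u => d u ^+ n * f u + d u ^+ n * h u)).
    apply: fa_add => //; [apply: fN | apply: hM]; apply: leq_trans NMn.
      exact: leq_addr.
    exact: leq_addl.
  by apply/funext => u; rewrite mulrDr.
- move=> f h [N fN] [M hM]; exists (N + M)%N => n NMn.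
  rewrite (_ : (fun u => _) = (fun u => (d u ^+ N * f u) * (d u ^+ (n - N) * h u))).
    apply: fa_mul => //; first exact: fN.
    by apply: hM; rewrite leq_subRL ?(leq_trans _ NMn) ?leq_addr.
  apply/funext => u; rewrite mulrACA -exprD subnKC //.
  by apply: leq_trans NMn; exact: leq_addr.
Qed.

Lemma localized_eq f h :
  (forall u, d u != 0 -> f u = h u) -> localized A d h -> localized A d f.
Proof.
move=> fh [N hN]; exists N.+1 => -[//|n] Nn.
rewrite (_ : (fun u => _) = (fun u => d u ^+ n.+1 * h u)).
  by apply: hN; exact: ltnW.
apply/funext => u; have [->|d0] := eqVneq (d u) 0; first by rewrite expr0n !mul0r.
by rewrite fh.
Qed.

End Localization.

(** Partition of unity: expand (a b + c d)^(N + M) = 1; each term contains b^N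
    or d^M. *)
Lemma localized_glue A (HA : fun_algebra A) (a b c d f : U -> K) :
  A a -> A b -> A c -> A d -> (forall u, a u * b u + c u * d u = 1) ->
  localized A b f -> localized A d f -> A f.
Proof.
move=> Aa Ab Ac Ad E [N bN] [M dM].
rewrite (_ : f = (fun u => \sum_(i < (N + M).+1)
  ((a u * b u) ^+ (N + M - i) * (c u * d u) ^+ i * 'C(N + M, i)%:R) * f u)); last first.
  apply/funext => u; rewrite -mulr_suml; under eq_bigr do rewrite mulr_natr.
  by rewrite -exprDn E expr1n mul1r.
apply: fa_sum => // i.
have [iM|iM] := leqP M i.
- rewrite (_ : (fun u => _) = (fun u =>
    ((a u * b u) ^+ (N + M - i) * c u ^+ i * 'C(N + M, i)%:R) * (d u ^+ i * f u))).
    apply: (fa_mul HA); last exact: dM.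
    by do ?[apply: (fa_mul HA) | apply: (fa_exp HA)] => //; exact: (fa_cst HA).
  by apply/funext => u; rewrite !exprMn; ring.
- have Ni : (N <= N + M - i)%N by rewrite -addnBA ?leq_addr // ltnW.
  rewrite (_ : (fun u => _) = (fun u =>
    (a u ^+ (N + M - i) * (c u * d u) ^+ i * 'C(N + M, i)%:R) *
    (b u ^+ (N + M - i) * f u))).
    apply: (fa_mul HA); last exact: bN.
    by do ?[apply: (fa_mul HA) | apply: (fa_exp HA)] => //; exact: (fa_cst HA).
  by apply/funext => u; rewrite !exprMn; ring.
Qed.

End FunctionAlgebras.

(** * Holomorphic representations of SL(2,C) are algebraic *)

Definition unip (K : pzRingType) (s : K) : 'M[K]_2 := mat2 1 s 0 1.
Definition lunip (K : pzRingType) (s : K) : 'M[K]_2 := mat2 1 0 s 1.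

Section Unipotents.
Variable R : realType.
Local Notation C := (R[i] : numFieldType).

Lemma is_derive_unip :
  is_derive (0 : C) (1 : C) (fun t : C => unip t : 'M[C]_2) (mat2 0 1 0 0).
Proof.
have -> : (fun t : C => unip t : 'M[C]_2) = cst 1%:M + (fun t => t *: mat2 0 1 0 0).
  apply/funext => t; apply/matrixP => i j; rewrite !mxE.
  by case: i => [[|[|?]]] // ?; case: j => [[|[|?]]] // ? /=;
    rewrite ?mulr1 ?mulr0 ?addr0 ?add0r.
rewrite -[X in is_derive _ _ _ X]add0r -[X in is_derive _ _ _ (0 + X)]scale1r.
by apply: is_deriveD; exact: (is_derive_scalel (k := id)).
Qed.

Lemma cvg_punctured_eq (f h : C -> C) :
  {for 0, continuous f} -> {for 0, continuous h} ->
  (forall s, s != 0 -> f s = h s) -> f 0 = h 0.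
Proof.
move=> /continuous_withinNx fc /continuous_withinNx hc fh.
have hc' : f @ (0 : C)^' --> h 0.
  apply: cvg_trans hc; apply: near_eq_cvg; near=> s.
  by apply: esym; apply: fh; near: s; exact: nbhs_dnbhs_neq.
exact: (cvg_unique (@norm_hausdorff _ _) fc hc').
Unshelve. all: by end_near. Qed.

(** Every s != 0 is a square, so f(s) = t^k f(1) with s = t^2.  If k is odd,
    t = -1 gives f = 0; if k = 2 j, then f(s) = s^j f(1), and a negative j is
    excluded by continuity at 0 unless f(1) = 0. *)
Lemma homogeneous_monomial (f : C -> C) (k : int) :
  {for 0, continuous f} ->
  (forall t s, t != 0 -> f (t ^+ 2 * s) = t ^ k * f s) ->
  exists (m : nat) (c : C), forall s, f s = c * s ^+ m.
Proof.
move=> fc fk.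
have f1 (s : C) : s != 0 -> exists2 t : C, t != 0 & s = t ^+ 2 /\ f s = t ^ k * f 1.
  move=> s0; exists (sqrtc s); first by rewrite sqrtc_eq0.
  by rewrite sqr_sqrtc -fk ?sqrtc_eq0 // sqr_sqrtc mulr1.
have cc (c : C) : {for 0, continuous (fun _ : C => c)} by exact: cst_continuous.
have ec m : {for 0, continuous (fun s : C => s ^+ m)}.
  elim: m => [|m IH]; first exact: cst_continuous.
  rewrite (_ : (fun s : C => _) = (fun s : C => s * s ^+ m)).
    by apply: continuousM; [exact: cvg_id | exact: IH].
  by apply/funext => s; rewrite exprS.
have Mc m (h : C -> C) : {for 0, continuous h} ->
    {for 0, continuous (fun s : C => h s * s ^+ m)}.
  by move=> hc; apply: continuousM; [exact: hc | exact: ec].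
have [ko|ke] := boolP (odd `|k|).
  exists 0, 0 => s; rewrite mul0r.
  have := fk (-1) s; rewrite oppr_eq0 oner_eq0 sqrrN expr1n mul1r => /(_ isT).
  have -> : (-1 : C) ^ k = -1.
    case: k ko {fk f1} => n; first by rewrite absz_nat -exprnP -signr_odd => ->.
    by rewrite NegzE abszN -exprnN -signr_odd => ->; rewrite expr1 invrN invr1.
  rewrite mulN1r => /eqP; rewrite -addr_eq0 -mulr2n mulrn_eq0 /=; exact: eqP.
have [j jk] : exists j, `|k|%N = (j * 2)%N.
  by exists (`|k|./2); rewrite muln2 -[LHS]odd_double_half (negPf ke).
case: k fk f1 jk {ke} => n fk f1 /= jk.
- have fm s : s != 0 -> f s = f 1 * s ^+ j.
    move=> /f1[t t0 [-> ->]]; rewrite -exprM mulnC -jk; exact: mulrC.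
  exists j, (f 1) => s; have [->|/fm //] := eqVneq s 0.
  exact: (cvg_punctured_eq fc (Mc j _ (cc (f 1))) fm).
- have fm s : s != 0 -> f s * s ^+ j = f 1.
    move=> /f1[t t0 [-> ->]]; rewrite -exprM mulnC -jk.
    by rewrite NegzE -exprnN mulrAC mulVf ?mul1r // expf_neq0.
  have f10 : f 1 = 0.
    have := cvg_punctured_eq (Mc j _ fc) (cc (f 1)) fm.
    by case: (j) jk => // j' _; rewrite expr0n mulr0.
  have fz s : s != 0 -> f s = 0.
    move=> s0; have /eqP := fm s s0.
    by rewrite f10 mulf_eq0 expf_eq0 (negPf s0) andbF orbF => /eqP.
  exists 0, 0 => s; rewrite mul0r; have [->|/fz //] := eqVneq s 0.
  exact: cvg_punctured_eq fc (cc 0) fz.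
Qed.

End Unipotents.

Section Regularity.
Variables (R : realType) (g : vectType R[i]) (br : g -> g -> g).
Variable rho : 'M[R[i]]_2 -> 'End(g).
Hypothesis Hrho : lie_aut_rep br rho.
Local Notation C := (R[i] : numFieldType).
Local Notation T t := (rho (torus t)).

Let w : 'M[R[i]]_2 := mat2 0 1 (-1) 0.
Let w' : 'M[R[i]]_2 := mat2 0 (-1) 1 0.

Let detw : \det w = 1. Proof. by rewrite det_mat2; ring. Qed.
Let detw' : \det w' = 1. Proof. by rewrite det_mat2; ring. Qed.
Let ww' : w' *m w = 1%:M.
Proof. by rewrite mat2_mul -mat2_1; congr mat2; ring. Qed.

Let det_unip (s : R[i]) : \det (unip s) = 1. Proof. by rewrite det_mat2; ring. Qed.
Let det_lunip (s : R[i]) : \det (lunip s) = 1. Proof. by rewrite det_mat2; ring. Qed.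

Let rho_mul3 A B D x : \det A = 1 -> \det B = 1 -> \det D = 1 ->
  rho (A *m B *m D) x = rho A (rho B (rho D x)).
Proof.
move=> dA dB dD; have dAB : \det (A *m B) = 1 by rewrite det_mulmx dA dB mul1r.
by rewrite (repM Hrho dAB dD) (repM Hrho dA dB) !comp_lfunE.
Qed.

Lemma rho_unip_continuous x (l : 'Hom(g, R[i]^o)) :
  {for 0, continuous (fun s : C => l (rho (unip s) x) : C)}.
Proof.
apply: differentiable_continuous; apply/derivable1_diffP.
have [] // : is_derive (0 : C) (1 : C) (fun s : C => l (rho (unip s) x))
    (l (drho rho (mat2 0 1 0 0) x)).
apply: (drhoP Hrho); last exact: is_derive_unip.
  exact: mat2_1.
by near=> t; rewrite det_unip.
Unshelve. all: by end_near. Qed.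

(** Conjugation by diag(t, 1/t) turns unip s into unip (t^2 s); a matrix
    coefficient between weight vectors of weights k i and k j is therefore
    multiplied by t^(k i - k j). *)
Lemma rho_unip_poly x (l : 'Hom(g, R[i]^o)) :
  exists p : {poly R[i]}, forall s, l (rho (unip s) x) = p.[s].
Proof.
have [n [e [k [eb ew]]]] := weight_basis Hrho.
have ef := basis_free eb.
have mono (i j : 'I_n) : exists mc : nat * R[i],
    forall s, coord e i (rho (unip s) e`_j) = mc.2 * s ^+ mc.1.
  have fc := @rho_unip_continuous e`_j (coordf e i).
  have [t s t0|m [c E]] := homogeneous_monomial (k := k i - k j) fc.
    have -> : unip (t ^+ 2 * s) = torus t *m unip s *m torus t^-1.
      by rewrite !mat2_mul invrK; congr mat2; field.
    have ti0 : t^-1 != 0 by rewrite invr_eq0.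
    rewrite (rho_mul3 _ (det_torus t0) (det_unip s) (det_torus ti0)).
    rewrite !coordfE (coord_rho_torus Hrho _ _ eb ew t0).
    rewrite (rho_torus_weight Hrho ti0 (ew j)) linearZ linearZ /= mulrA.
    by rewrite exprz_inv -expfzDr.
  by exists (m, c) => s; rewrite -E coordfE.
have {}mono (i : 'I_n) : exists mc : 'I_n -> nat * R[i],
    forall (j : 'I_n) s, coord e i (rho (unip s) e`_j) = (mc j).2 * s ^+ (mc j).1.
  by have [mc] := choice (mono i); exists mc.
have {mono}[mc Hmc] := choice mono.
exists (\sum_(i < n) \sum_(j < n)
  (l e`_i * coord e j x * (mc i j).2) *: 'X^((mc i j).1)) => s.
rewrite (functional_coord l _ eb) horner_sum; apply: eq_bigr => i _.
rewrite -coordfE -[coordf e i _]comp_lfunE (functional_coord _ x eb).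
rewrite horner_sum mulr_suml; apply: eq_bigr => j _.
by rewrite comp_lfunE coordfE Hmc hornerZ hornerXn; ring.
Qed.

(** The Weyl element conjugates the upper unipotent group to the lower one. *)
Lemma rho_lunip_poly x (l : 'Hom(g, R[i]^o)) :
  exists p : {poly R[i]}, forall s, l (rho (lunip s) x) = p.[s].
Proof.
have [p Hp] := rho_unip_poly (rho w' x) (l \o rho w)%VF.
exists (p \Po (- 'X)) => s.
have -> : lunip s = w *m unip (- s) *m w'.
  by rewrite !mat2_mul; congr mat2; ring.
rewrite (rho_mul3 _ detw (det_unip _) detw').
by rewrite horner_comp hornerN hornerX -Hp !comp_lfunE.
Qed.

Section Family.
Variables (U : Type) (A : set (U -> R[i])) (HA : fun_algebra A).

(** Where d = M_11 is invertible, M is the product of unip (b / d),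
    lunip (c d) and torus (1 / d), with b = M_01 and c = M_10. *)
Let big_cell (M : U -> 'M[R[i]]_2) x (l : 'Hom(g, R[i]^o)) :
  (forall u, \det (M u) = 1) -> (forall i j, A (fun u => M u i j)) ->
  localized A (fun u => M u ord_max ord_max) (fun u => l (rho (M u) x)).
Proof.
move=> detM AM; set d := fun u => M u ord_max ord_max.
have [n [e [k [eb ew]]]] := weight_basis Hrho.
have [p Hp] := choice (fun i : 'I_n => rho_unip_poly e`_i l).
have HqP (ij : 'I_n * 'I_n) : exists q : {poly R[i]},
    forall s, coord e ij.1 (rho (lunip s) e`_(ij.2)) = q.[s].
  have [q Hq] := rho_lunip_poly e`_(ij.2) (coordf e ij.1).
  by exists q => s; rewrite -Hq coordfE.
have {HqP}[q Hq] := choice HqP.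
have Ad : A d by exact: AM.
have HL := localized_algebra HA Ad.
apply: (@localized_eq _ _ A d _ (fun u => \sum_(j < n) \sum_(i < n)
  (coord e j x * (d u)^-1 ^ k j * (p i).[M u ord0 ord_max * (d u)^-1] *
   (q (i, j)).[M u ord_max ord0 * d u]))).
  move=> u d0.
  have ME : M u = unip (M u ord0 ord_max * (d u)^-1) *m
      lunip (M u ord_max ord0 * d u) *m torus (d u)^-1.
    rewrite [LHS]mat2_eta !mat2_mul invrK; have := detM u.
    rewrite [in X in X -> _](mat2_eta (M u)) det_mat2 -/(d u) => E.
    have -> : M u ord0 ord0 = (1 + M u ord0 ord_max * M u ord_max ord0) / d u.
      by apply: (mulIf d0); rewrite divfK // -E; ring.
    by congr mat2; rewrite -/(d u); field.
  rewrite [in LHS]ME.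
  have di0 : (d u)^-1 != 0 by rewrite invr_eq0.
  rewrite (rho_mul3 _ (det_unip _) (det_lunip _) (det_torus di0)).
  set N := unip _; set N' := lunip _; set D := torus _.
  transitivity ((l \o rho N \o rho N' \o rho D)%VF x); first by rewrite !comp_lfunE.
  rewrite (functional_coord _ x eb).
  apply: eq_bigr => j _; rewrite comp_lfunE (rho_torus_weight Hrho di0 (ew j)).
  rewrite functionalZ comp_lfunE (functional_coord _ (rho N' _) eb).
  rewrite !mulr_sumr; apply: eq_bigr => i _.
  by rewrite comp_lfunE Hp -(Hq (i, j)) /=; ring.
have AL i j : localized A d (fun u => M u i j) by apply: sub_localized.
have di := localized_inv HA Ad.
have dk : localized A d (fun u => (d u)^-1^-1).
  rewrite (_ : (fun u => _) = d); first exact: AL.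
  by apply/funext => u; rewrite invrK.
apply: (fa_sum HL) => j; apply: (fa_sum HL) => i.
apply: (fa_mul HL); last by apply: (fa_horner HL); apply: (fa_mul HL); exact: AL.
apply: (fa_mul HL); last by apply: (fa_horner HL); apply: (fa_mul HL).
by apply: (fa_mul HL); [exact: (fa_cst HL) | exact: (fa_exprz HL)].
Qed.

(** Both entries of the second column are reached by the big cell, one of them
    after multiplication by the Weyl element; they generate the unit ideal
    because the determinant is 1. *)
Lemma rho_regular (M : U -> 'M[R[i]]_2) x (l : 'Hom(g, R[i]^o)) :
  (forall u, \det (M u) = 1) -> (forall i j, A (fun u => M u i j)) ->
  A (fun u => l (rho (M u) x)).
Proof.
move=> detM AM.
have wM u : w *m M u = mat2 (M u ord_max ord0) (M u ord_max ord_max)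
    (- M u ord0 ord0) (- M u ord0 ord_max).
  by rewrite {1}(mat2_eta (M u)) mat2_mul; congr mat2; ring.
have H1 := big_cell x l detM AM.
have H2 : localized A (fun u => - M u ord0 ord_max) (fun u => l (rho (M u) x)).
  have := @big_cell (fun u => w *m M u) x (l \o rho w')%VF.
  have -> : (fun u => (w *m M u) ord_max ord_max) = (fun u => - M u ord0 ord_max).
    by apply/funext => u; rewrite wM mxE.
  have -> : (fun u => (l \o rho w')%VF (rho (w *m M u) x)) = (fun u => l (rho (M u) x)).
    apply/funext => u; rewrite comp_lfunE -[rho w' _]comp_lfunE -(repM Hrho) //.
      by rewrite mulmxA ww' mul1mx.
    by rewrite det_mulmx detw mul1r.
  apply=> [u|i j]; first by rewrite det_mulmx detw mul1r.
  rewrite (_ : (fun u => _) = (fun u =>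
    nth 0 (nth [::] [:: [:: M u ord_max ord0; M u ord_max ord_max];
      [:: - M u ord0 ord0; - M u ord0 ord_max]] i) j)); last first.
    by apply/funext => u; rewrite wM mxE.
  by case: i => [[|[|?]]] // ?; case: j => [[|[|?]]] // ? /=; try apply: (fa_opp HA).
apply: (localized_glue HA _ _ _ _ _ H1 H2); [exact: (AM ord0 ord0) | exact: AM |
  exact: (AM ord_max ord0) | exact: (fa_opp HA) |].
move=> u; have := detM u; rewrite {1}(mat2_eta (M u)) det_mat2 => <-; ring.
Qed.

End Family.
End Regularity.

(** * Polynomials along lines *)

Section PolynomialIdentities.
Variable R : numDomainType.

Lemma poly_eq0_off0 (p : {poly R}) : (forall t, t != 0 -> p.[t] = 0) -> p = 0.
Proof.
move=> p0; apply: contra_eq (erefl p) => pn0.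
(* 1, ..., size p are more roots than p can have. *)
pose rs : seq R := [seq i.+1%:R | i <- iota 0 (size p)].
have := @max_poly_roots _ p rs pn0.
rewrite size_map size_iota ltnn => H.
have : false; last by [].
apply: H.
- by apply/allP => _ /mapP[i _ ->]; apply/rootP; apply: p0; rewrite pnatr_eq0.
- by rewrite map_inj_uniq ?iota_uniq // => i j /eqP; rewrite eqr_nat eqSS => /eqP.
Qed.

Lemma poly_ext (p q : {poly R}) : (forall t, p.[t] = q.[t]) -> p = q.
Proof.
move=> pq; apply/eqP; rewrite -subr_eq0; apply/eqP; apply: poly_eq0_off0 => t _.
by rewrite hornerD hornerN pq subrr.
Qed.

End PolynomialIdentities.

(** Separates the homogeneous components of a function from its values at the
    points t u; multiplication by a power of t clears negative exponents. *)
Lemma laurent_polynomial_eq0 (K : numFieldType) (s : seq int) (y : int -> K) :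
  uniq s -> (forall t : K, t != 0 -> \sum_(d <- s) t ^ d * y d = 0) ->
  forall d, d \in s -> y d = 0.
Proof.
move=> us s0 d ds.
(* A common bound for the exponents, so that e + N >= 0 throughout. *)
pose N := (\sum_(e <- s) `|e|)%N.
have eN e : e \in s -> (0 <= e + N%:Z)%R.
  move=> es; have : (`|e| <= N)%N by rewrite /N (big_rem e) //= leq_addr.
  case: e {es} => n //= nN.
  by rewrite NegzE addrC subr_ge0 lez_nat.
pose p : {poly K} := \sum_(e <- s) y e *: 'X^(`|e + N%:Z|).
have p0 : p = 0.
  apply: poly_eq0_off0 => t t0; rewrite horner_sum.
  transitivity (t ^ N%:Z * \sum_(e <- s) t ^ e * y e); last by rewrite s0 ?mulr0.
  rewrite mulr_sumr big_seq [RHS]big_seq; apply: eq_bigr => e es.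
  rewrite hornerZ hornerXn mulrA -expfzDr // [N%:Z + e]addrC.
  by rewrite -[in RHS](gez0_abs (eN e es)) mulrC.
have := congr1 (fun q : {poly K} => q`_(`|d + N%:Z|)) p0.
rewrite coef0 coef_sum (bigD1_seq d) //= coefZ coefXn eqxx mulr1.
rewrite big_seq_cond big1 ?addr0 // => e /andP[es ed].
rewrite coefZ coefXn; case: eqP => [E|]; last by rewrite mulr0.
have := gez0_abs (eN e es); rewrite -E (gez0_abs (eN d ds)) => /addIr de.
by rewrite de eqxx in ed.
Qed.

Section Slices.
Variable R : realType.
Implicit Types (p q : mpoly 2 R[i]) (v w : 'cV[R[i]]_2).

Lemma polyevalD v p q : polyeval (p + q) v = polyeval p v + polyeval q v.
Proof. exact: mevalD. Qed.
Lemma polyevalM v p q : polyeval (p * q) v = polyeval p v * polyeval q v.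
Proof. exact: mevalM. Qed.
Lemma polyevalC v c : polyeval (mpolyC 2 c) v = c.
Proof. exact: mevalC. Qed.
Lemma polyevalXn v p n : polyeval (p ^+ n) v = polyeval p v ^+ n.
Proof.
elim: n => [|n IH]; first by rewrite !expr0; exact: meval1.
by rewrite !exprS polyevalM IH.
Qed.
Lemma polyevalX v i : polyeval (mpolyX R[i] (mnm1 i)) v = v i 0.
Proof. exact: mevalXU. Qed.

(** Restricting to the line t |-> v + t w turns the partial derivatives of p
    into the derivative of a polynomial in one variable.  Identities between
    values of p can then be differentiated: polynomials in one variable are
    determined by their values. *)
Definition slice v w p : {poly R[i]} :=
  mmap (@polyC R[i]) (fun i => (v i 0)%:P + w i 0 *: 'X) p.

Lemma horner_slice v w p t : (slice v w p).[t] = polyeval p (v + t *: w).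
Proof.
rewrite /slice /polyeval /meval /mmap horner_sum; apply: eq_bigr => m _.
rewrite hornerM hornerC; congr (_ * _); rewrite /mmap1 horner_prod.
by apply: eq_bigr => i _; rewrite horner_exp !hornerE !mxE [t * _]mulrC.
Qed.

Definition gradient p v w : R[i] := \sum_(i < 2) polyeval (mderiv i p) v * w i 0.

Lemma deriv_slice v w p : (slice v w p)^`().[0] = gradient p v w.
Proof.
pose E p := (slice v w p)^`().[0] = gradient p v w.
have s0 q : (slice v w q).[0] = polyeval q v by rewrite horner_slice scale0r addr0.
have E1 : E 1.
  rewrite /E /gradient /slice rmorph1 -polyC1 derivC horner0 big1 // => i _.
  by rewrite -mpolyC1 mderivC -mpolyC0 polyevalC mul0r.
have EM q r : E q -> E r -> E (q * r).
  rewrite /E /gradient => Eq Er.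
  rewrite /slice rmorphM derivM hornerD !hornerM -/(slice v w q) -/(slice v w r).
  rewrite Eq Er !s0 mulr_suml mulr_sumr -big_split /=; apply: eq_bigr => i _.
  rewrite mderivM polyevalD !polyevalM mulrDl.
  by rewrite [X in X + _ = _]mulrAC [X in _ + X = _]mulrA.
have ED c q r : E q -> E r -> E (c *: q + r).
  rewrite /E /gradient => Eq Er.
  rewrite /slice mmapD mmapZ derivD derivM derivC mul0r add0r hornerD hornerM hornerC.
  rewrite -/(slice v w q) -/(slice v w r) Eq Er mulr_sumr -big_split /=.
  apply: eq_bigr => i _.
  rewrite mderivD mderivZ -mul_mpolyC polyevalD polyevalM polyevalC.
  by rewrite mulrDl mulrA.
have EX i : E (mpolyX R[i] (mnm1 i)).
  rewrite /E /gradient /slice mmapX mmap1U derivD derivC derivZ derivX add0r.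
  rewrite hornerZ -polyC1 hornerC mulr1 (bigD1 i) //= big1 ?addr0.
    rewrite mderivX mnm1E eqxx scale1r -{1}[mnm1 i]add0m addmK mpolyX0.
    by rewrite -mpolyC1 polyevalC mul1r.
  move=> k ki; rewrite mderivX mnm1E eq_sym (negPf ki) scale0r -mpolyC0 polyevalC.
  by rewrite mul0r.
have EXn i n : E (mpolyX R[i] (mnm1 i) ^+ n).
  elim: n => [|n IH]; first by rewrite expr0.
  by rewrite exprS; exact: EM (EX i) IH.
elim/mpolyind: p => [|c m p _ _ Ep].
  by have := ED (-1) 1 1 E1 E1; rewrite scaleN1r addNr.
apply: (ED _ _ _ _ Ep); rewrite mpolyXE_id.
by apply: (big_ind E E1 EM) => i _; exact: EXn.
Qed.

(** The chain rule for p (B v) = c p v. *)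
Lemma gradient_equivariant p (B : 'M[R[i]]_2) c v w :
  (forall v, polyeval p (B *m v) = c * polyeval p v) ->
  gradient p (B *m v) (B *m w) = c * gradient p v w.
Proof.
move=> pB; rewrite -!deriv_slice.
have -> : slice (B *m v) (B *m w) p = c *: slice v w p.
  apply: poly_ext => t; rewrite hornerZ !horner_slice -pB.
  by rewrite mulmxDr -scalemxAr.
by rewrite derivZ hornerZ.
Qed.

Lemma homogeneous_eval d p (t : R[i]) v : homogeneous d p ->
  polyeval p (t *: v) = t ^+ d * polyeval p v.
Proof.
move=> /dhomogP hp; rewrite /polyeval !mevalE mulr_sumr big_seq [RHS]big_seq.
apply: eq_bigr => m mp; rewrite mulrCA; congr (_ * _).
have -> : d = mdeg m by rewrite -(hp m mp).
rewrite mdegE -prodrXr -big_split /=.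
by apply: eq_bigr => i _; rewrite !mxE exprMn.
Qed.

Lemma euler d p v : homogeneous d p -> gradient p v v = d%:R * polyeval p v.
Proof.
move=> hp; rewrite -deriv_slice.
have -> : slice v v p = polyeval p v *: ('X + 1%:P) ^+ d.
  apply: poly_ext => t; rewrite horner_slice hornerZ horner_exp !hornerE.
  by rewrite -{1}[v]scale1r -scalerDl (homogeneous_eval _ _ hp) mulrC addrC.
rewrite derivZ hornerZ deriv_exp derivD derivX derivC addr0 mul1r hornerMn horner_exp.
by rewrite !hornerE expr1n mulrC.
Qed.

End Slices.

(** * The ring C[X,Y,1/P] and the equivariant frame *)

Section Laurent.
Variables (R : realType) (P : mpoly 2 R[i]).
Local Notation U := (nonzeros P).
Implicit Types (a b : U -> R[i]) (u v : U).

Lemma laurent_algebra : fun_algebra (laurent P).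
Proof.
split.
- move=> c; exists (mpolyC 2 c), 0%N => u.
  by rewrite polyevalC expr0 divr1.
- move=> f h [q [n fq]] [r [m hr]]; exists (q * P ^+ m + r * P ^+ n), (n + m)%N => u.
  rewrite polyevalD !polyevalM !polyevalXn exprD fq hr.
  have /expf_neq0 Pn := valP u.
  by rewrite -addf_div // ?Pn //; congr (_ / _); rewrite mulrC.
- move=> f h [q [n fq]] [r [m hr]]; exists (q * r), (n + m)%N => u.
  by rewrite polyevalM exprD fq hr mulf_div.
Qed.

Lemma laurent_Phi1 i j : laurent P (fun u => Phi1 P (val u) i j).
Proof.
have HL := laurent_algebra.
have Hq q : laurent P (fun u => polyeval q (val u)).
  by exists q, 0%N => u; rewrite expr0 divr1.
have HX k : laurent P (fun u => val u k 0).
  by exists (mpolyX R[i] (mnm1 k)), 0%N => u; rewrite polyevalX expr0 divr1.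
have HN : laurent P (fun u => ((total_degree P)%:R * polyeval P (val u))^-1).
  exists (mpolyC 2 (total_degree P)%:R^-1), 1%N => u.
  by rewrite polyevalC expr1 invfM.
have ord2 (k : 'I_2) : k = ord0 \/ k = ord_max.
  by case: k => [[|[|?]]] // ?; [left | right]; apply/val_inj.
have [->|->] := ord2 i; have [->|->] := ord2 j.
- rewrite (_ : (fun u => _) = (fun u => polyeval (mderiv ord_max P) (val u) *
    ((total_degree P)%:R * polyeval P (val u))^-1)).
    exact: fa_mul HL _ _ (Hq _) HN.
  by apply/funext => u; rewrite mxE.
- rewrite (_ : (fun u => _) = (fun u => val u 0 0)); first exact: HX.
  by apply/funext => u; rewrite mxE.
- rewrite (_ : (fun u => _) = (fun u => - polyeval (mderiv ord0 P) (val u) *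
    ((total_degree P)%:R * polyeval P (val u))^-1)).
    exact: fa_mul HL _ _ (fa_opp HL (Hq _)) HN.
  by apply/funext => u; rewrite mxE.
- rewrite (_ : (fun u => _) = (fun u => val u ord_max 0)); first exact: HX.
  by apply/funext => u; rewrite mxE.
Qed.

(** By the chain rule the gradient of P is multiplied by c and by the inverse
    transpose of B; the symplectic gradient is then multiplied by c and B, as
    det B = 1, and the factor c disappears in the quotient by P. *)
Lemma Phi1_equivariant (B : 'M[R[i]]_2) c (v : 'cV[R[i]]_2) : \det B = 1 ->
  (forall w : 'cV[R[i]]_2, polyeval P (B *m w) = c * polyeval P w) ->
  polyeval P (B *m v) != 0 -> Phi1 P (B *m v) = B *m Phi1 P v.
Proof.
move=> dB PB PBv.
have c0 : c != 0 by apply: contraNneq PBv => c0; rewrite PB c0 mul0r.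
have gr w := gradient_equivariant v w PB.
have g2 (x y : 'cV[R[i]]_2) : gradient P x y =
    polyeval (mderiv ord0 P) x * y ord0 0 + polyeval (mderiv ord_max P) x * y ord_max 0.
  rewrite /gradient !big_ord_recl big_ord0 addr0.
  by rewrite (_ : lift ord0 ord0 = ord_max) //; apply/val_inj.
have mulB (w : 'cV[R[i]]_2) i :
    (B *m w) i 0 = B i ord0 * w ord0 0 + B i ord_max * w ord_max 0.
  rewrite mxE !big_ord_recl big_ord0 addr0.
  by rewrite (_ : lift ord0 ord0 = ord_max) //; apply/val_inj.
have := gr (delta_mx 0 0); have := gr (delta_mx ord_max 0).
rewrite !g2 !mulB !mxE /= !mulr0 !mulr1 ?addr0 ?add0r.
rewrite /Phi1 PB; move: dB; rewrite (mat2_eta B) det_mat2 mat2_mul -(mat2_eta B) !mulB.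
set p0 := polyeval (mderiv ord0 P) (B *m v).
set p1 := polyeval (mderiv ord_max P) (B *m v).
set q0 := polyeval (mderiv ord0 P) v; set q1 := polyeval (mderiv ord_max P) v.
set N := (total_degree P)%:R.
move: (B 0 0) (B 0 ord_max) (B ord_max 0) (B ord_max ord_max) p0 p1 q0 q1 N (polyeval P v).
move=> b00 b01 b10 b11 p0 p1 q0 q1 N Pv dB E1 E0.
have Np : (N * (c * Pv))^-1 = c^-1 * (N * Pv)^-1 by rewrite mulrCA invfM.
congr mat2; rewrite ?Np.
- apply: (mulfI c0); rewrite mulrCA (mulrA c c^-1) mulfV // mul1r.
  rewrite mulrDr; rewrite (_ : p1 = b00 * (c * q1) - b01 * (c * q0)); last first.
    by rewrite -E1 -E0 -[LHS]mul1r -dB; ring.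
  by ring.
- apply: (mulfI c0); rewrite mulrCA (mulrA c c^-1) mulfV // mul1r.
  rewrite mulrDr; rewrite (_ : - p0 = b10 * (c * q1) - b11 * (c * q0)); last first.
    by rewrite -E1 -E0 -[LHS]mul1r -dB; ring.
  by ring.
Qed.

Section Positive.
Hypothesis Phom : homogeneous (total_degree P) P.
Hypothesis Pdeg : (0 < total_degree P)%N.
Local Notation D := (total_degree P).

Lemma det_Phi1 u : \det (Phi1 P (val u)) = 1.
Proof.
rewrite det_mat2; have := euler (val u) Phom.
rewrite /gradient !big_ord_recl big_ord0 addr0.
rewrite (_ : lift ord0 ord0 = ord_max); last by apply/val_inj.
have Dn0 : D%:R != 0 :> R[i] by rewrite pnatr_eq0 -lt0n.
have Pn0 : polyeval P (val u) != 0 by exact: (valP u).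
set N := D%:R * _ => E.
have N0 : N != 0 by rewrite mulf_neq0.
have aux (K : fieldType) (p q x y n : K) : n != 0 -> q * x + p * y = n ->
    p / n * y - x * (- q / n) = 1.
  move=> n0 E'; apply: (mulIf n0); rewrite mul1r -[in RHS]E'; by field.
exact: aux N0 E.
Qed.

(** The second column is multiplied by t and the first, a quotient of forms of
    degrees deg P - 1 and deg P, by 1 / t. *)
Lemma Phi1_scale (t : R[i]) (v : 'cV[R[i]]_2) : t != 0 ->
  Phi1 P (t *: v) = Phi1 P v *m torus t^-1.
Proof.
move=> t0.
have Pt (w : 'cV[R[i]]_2) : polyeval P (t%:M *m w) = t ^+ D * polyeval P w.
  by rewrite mul_scalar_mx (homogeneous_eval _ _ Phom).
have gr i : t * polyeval (mderiv i P) (t *: v) = t ^+ D * polyeval (mderiv i P) v.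
  have gd x (c : R[i]) : gradient P x (c *: delta_mx i 0) = polyeval (mderiv i P) x * c.
    rewrite /gradient (bigD1 i isT) big1; last first.
      by move=> j ji; rewrite !mxE (negPf ji) /= !mulr0.
    by rewrite !mxE !eqxx mulr1; exact: addr0.
  have := gradient_equivariant v (1 *: delta_mx i 0) Pt.
  by rewrite !mul_scalar_mx scalerA !gd !mulr1 => <-; exact: mulrC.
rewrite /Phi1 (homogeneous_eval _ _ Phom) mat2_mul !mxE invrK !mulr0 !addr0 !add0r.
have tD : t ^+ D != 0 by rewrite expf_neq0.
have H i : polyeval (mderiv i P) (t *: v) = t^-1 * (t ^+ D * polyeval (mderiv i P) v).
  by rewrite -gr mulKf.
have Nt : (D%:R * (t ^+ D * polyeval P v))^-1 = (t ^+ D)^-1 * (D%:R * polyeval P v)^-1.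
  by rewrite mulrCA invfM.
have aux (K : fieldType) (x q n m : K) : m != 0 ->
    x * (m * q) * (m^-1 * n) = q * n * x.
  by move=> m0; field.
congr mat2; rewrite ?H ?Nt.
- exact: aux.
- exact: mulrC.
- by rewrite -mulrN -mulrN; exact: aux.
- exact: mulrC.
Qed.

Definition scales (e : int) a := forall (t : R[i]) u v,
  t != 0 -> val v = t *: val u -> a v = t ^ e * a u.

Lemma nonzero_scale (t : R[i]) u : t != 0 -> exists v : U, val v = t *: val u.
Proof.
move=> t0; have tu : polyeval P (t *: val u) != 0.
  by rewrite (homogeneous_eval _ _ Phom) mulf_neq0 ?expf_neq0 //; exact: (valP u).
by exists (exist (fun w => is_true (polyeval P w != 0)) _ tu).
Qed.

Lemma laurent_deg_sub e a : laurent_deg P e a -> laurent P a.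
Proof. by move=> [q [m [n [_ _ E]]]]; exists q, n. Qed.

Lemma laurent_deg_scales e a : laurent_deg P e a -> scales e a.
Proof.
move=> [q [m [n [hq -> E]]]] t u v t0 vu.
rewrite !E vu !(homogeneous_eval _ _ hq) (homogeneous_eval _ _ Phom).
rewrite expfzDr // exprMn -exprM mulnC invfM mulrACA -exprnN.
by [].
Qed.

(** Enlarging the exponent n of the denominator makes the degree of the
    numerator nonnegative; |e| extra factors suffice as deg P > 0. *)
Lemma degree_shift (e : int) n : exists m : nat, m%:Z = e + ((n + `|e|) * D)%N%:Z.
Proof.
have : 0 <= e + ((n + `|e|) * D)%N%:Z.
  have ej : (`|e| <= (n + `|e|) * D)%N.
    by apply: leq_trans (leq_addl n `|e|) _; exact: leq_pmulr.
  case: e ej => j //= ej.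
  by rewrite NegzE addrC subr_ge0 lez_nat.
by move=> /gez0_abs E; exists `|(e + ((n + `|e|) * D)%N%:Z)%R|%N.
Qed.

Lemma polyeval_partition (q : mpoly 2 R[i]) k (v : 'cV[R[i]]_2) : (msize q <= k)%N ->
  polyeval q v = \sum_(m < k) polyeval (pihomog mdeg m q) v.
Proof.
move=> qk; rewrite {1}(pihomog_partitionE qk) /polyeval.
exact: (big_morph _ (mevalD _) (meval0 _)).
Qed.

(** Write a = q / P^n with n large enough for the expected degree m of q to be
    nonnegative.  At each point u, comparing q (t u) = t^m q (u) with the
    expansion of q into forms shows that q agrees with its component of degree
    m. *)
Lemma scales_laurent_deg e a : laurent P a -> scales e a -> laurent_deg P e a.
Proof.
move=> [q0 [n0 aq0]] ae.
pose n := (n0 + `|e|)%N; pose q := q0 * P ^+ `|e|.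
have aq u : a u = polyeval q (val u) / polyeval P (val u) ^+ n.
  have Pn0 : polyeval P (val u) != 0 by exact: (valP u).
  rewrite aq0 /q /n polyevalM polyevalXn exprD -mulf_div divff ?mulr1 //.
  exact: expf_neq0.
have [m em] := degree_shift e n0.
exists (pihomog mdeg m q), m, n; split; first exact: pihomogP.
  by rewrite em addrK.
move=> u; rewrite aq; congr (_ / _).
pose k := maxn (msize q) m.+1.
have qk : (msize q <= k)%N by exact: leq_maxl.
have mk : (m < k)%N by exact: leq_maxr.
(* q (t u) - t^m q (u) as a polynomial in t. *)
pose p : {poly R[i]} := \poly_(i < k) polyeval (pihomog mdeg i q) (val u) -
  polyeval q (val u) *: 'X^m.
have p0 : p = 0.
  apply: poly_eq0_off0 => t t0; rewrite hornerD hornerN hornerZ hornerXn horner_poly.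
  apply/eqP; rewrite subr_eq0; apply/eqP.
  have [v vu] := nonzero_scale u t0.
  have Pn0 : polyeval P (val u) ^+ n != 0 by apply: expf_neq0; exact: (valP u).
  have := ae t u v t0 vu; rewrite !aq vu (homogeneous_eval _ _ Phom) exprMn -exprM.
  rewrite (polyeval_partition _ qk) => E.
  have E2 : polyeval q (val u) * t ^+ m = polyeval q (val u) * (t ^ e * t ^+ (D * n)).
    by congr (_ * _); rewrite [(D * n)%N]mulnC -[t ^+ m]/(t ^ m%:Z) em expfzDr.
  have tD : t ^+ (D * n) != 0 by exact: expf_neq0.
  rewrite E2; under eq_bigr => i _ do
    rewrite mulrC -(homogeneous_eval _ _ (pihomogP mdeg i q)).
  have aux (K : fieldType) (x y z c d : K) : c != 0 -> d != 0 ->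
      x / (c * d) = z * (y / d) -> x = y * (z * c).
    move=> c0 d0 /(congr1 (fun w => w * (c * d))).
    rewrite divfK ?mulf_neq0 // => ->; by field.
  exact: aux tD Pn0 E.
have := congr1 (fun r : {poly R[i]} => r`_m) p0.
rewrite coef0 coefB coef_poly mk coefZ coefXn eqxx mulr1 => /eqP.
by rewrite subr_eq0 => /eqP ->.
Qed.

Lemma laurent_degP e a : laurent_deg P e a <-> laurent P a /\ scales e a.
Proof.
split=> [ae|[]]; last exact: scales_laurent_deg.
by split; [exact: laurent_deg_sub ae | exact: laurent_deg_scales].
Qed.

Lemma laurent_span a : laurent P a -> exists (s : seq int) (F : int -> U -> R[i]),
  [/\ uniq s, forall d, laurent_deg P d (F d) & forall u, a u = \sum_(d <- s) F d u].
Proof.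
move=> [q [n aq]]; pose k := msize q.
pose F (d : int) u := if 0 <= d + (n * D)%N%:Z
  then polyeval (pihomog mdeg `|(d + (n * D)%N%:Z)%R|%N q) (val u) /
    polyeval P (val u) ^+ n
  else 0.
exists [seq m%:Z - (n * D)%N%:Z | m <- iota 0 k], F; split.
- by rewrite map_inj_uniq ?iota_uniq // => i j /addIr [].
- move=> d; case: (boolP (0 <= d + (n * D)%N%:Z)) => d0; rewrite /F.
    exists (pihomog mdeg `|(d + (n * D)%N%:Z)%R|%N q), `|(d + (n * D)%N%:Z)%R|%N, n.
    split; [exact: pihomogP | by rewrite gez0_abs // addrK |].
    by move=> u; rewrite d0.
  have [m dm] := degree_shift d 0.
  exists 0, m, `|d|%N; split; [exact: dhomog0 | by rewrite dm addrK |].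
  by move=> u; rewrite (negPf d0) -mpolyC0 polyevalC mul0r.
- move=> u; rewrite aq (polyeval_partition _ (leqnn k)) mulr_suml.
  rewrite big_map (_ : iota 0 k = index_iota 0 k); last by rewrite /index_iota subn0.
  rewrite big_mkord; apply: eq_bigr => i _.
  by rewrite /F subrK.
Qed.

End Positive.
End Laurent.

(** * Vector-valued functions and transport of gradings *)

Section Tensors.
Variables (R : realType) (g : vectType R[i]) (U : Type).

Lemma tensorP (A : set (U -> R[i])) (f : U -> g) : fun_algebra A ->
  tensor g A f <-> forall l : 'Hom(g, R[i]^o), A (fun u => l (f u)).
Proof.
move=> HA; split.
  move=> [m [t [At ft]]] l.
  rewrite (_ : (fun u => _) = (fun u => \sum_(i < m) (t i).2 u * l (t i).1)).
    apply: (fa_sum HA) => i; apply: (fa_mul HA); last exact: (fa_cst HA).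
    by have [] := At i.
  apply/funext => u; rewrite ft linear_sum.
  by apply: eq_bigr => i _; exact: functionalZ.
move=> Af; pose b := vbasis {:g}.
exists (\dim {:g}), (fun i => (b`_(val i), fun u => coord b i (f u))).
split=> [i|u /=]; last exact: coord_vbasis (memvf _).
split=> //=; have -> : (fun u => coord b i (f u)) = (fun u => coordf b i (f u)).
  by apply/funext => u; rewrite coordfE.
exact: Af.
Qed.

Lemma tensor_coord (A : set (U -> R[i])) (f : U -> g) n (e : n.-tuple g) i :
  fun_algebra A -> tensor g A f -> A (fun u => coord e i (f u)).
Proof.
move=> HA /(tensorP _ HA) Af.
have -> : (fun u => coord e i (f u)) = (fun u => coordf e i (f u)).
  by apply/funext => u; rewrite coordfE.
exact: Af.
Qed.

Section Bilinear.
Variables (br : g -> g -> g) (A : set (U -> R[i])).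
Hypotheses (Hbr : lie_bracket br) (HA : fun_algebra A).

Lemma brD_l x y z : br (x + y) z = br x z + br y z.
Proof. by have := br_linearl Hbr z 1 x y; rewrite !scale1r. Qed.
Lemma brD_r x y z : br x (y + z) = br x y + br x z.
Proof. by have := br_linearr Hbr x 1 y z; rewrite !scale1r. Qed.
Lemma br0_l x : br 0 x = 0.
Proof. by apply: (addrI (br 0 x)); rewrite -brD_l !addr0. Qed.
Lemma br0_r x : br x 0 = 0.
Proof. by apply: (addrI (br x 0)); rewrite -brD_r !addr0. Qed.
Lemma brZ_l a x y : br (a *: x) y = a *: br x y.
Proof. by have := br_linearl Hbr y a x 0; rewrite !addr0 br0_l addr0. Qed.
Lemma brZ_r a x y : br x (a *: y) = a *: br x y.
Proof. by have := br_linearr Hbr x a y 0; rewrite !addr0 br0_r addr0. Qed.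

Lemma br_sum n m (x : 'I_n -> g) (y : 'I_m -> g) :
  br (\sum_i x i) (\sum_j y j) = \sum_i \sum_j br (x i) (y j).
Proof.
rewrite (big_morph (br^~ _) (fun a b => brD_l a b _) (br0_l _)).
by apply: eq_bigr => i _; rewrite (big_morph _ (brD_r _) (br0_r _)).
Qed.

Lemma tensor_br (f h : U -> g) : tensor g A f -> tensor g A h -> tensor g A (fbr br f h).
Proof.
move=> [n [s [As fs]]] [m [t [At ht]]]; apply/tensorP => // l.
rewrite (_ : (fun u => _) = (fun u => \sum_(i < n) \sum_(j < m)
    ((s i).2 u * (t j).2 u) * l (br (s i).1 (t j).1))).
  apply: (fa_sum HA) => i; apply: (fa_sum HA) => j.
  apply: (fa_mul HA); last exact: (fa_cst HA).
  by apply: (fa_mul HA); [have [] := As i | have [] := At j].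
apply/funext => u; rewrite /fbr fs ht br_sum linear_sum; apply: eq_bigr => i _.
rewrite linear_sum; apply: eq_bigr => j _.
by rewrite brZ_l brZ_r scalerA; exact: functionalZ.
Qed.
End Bilinear.

(** Linearity and brackets are transported pointwise; injectivity of each L u
    is what keeps the sum of the homogeneous components direct. *)
Lemma graded_transport (br : g -> g -> g) A Ad M Md N Nd (L L' : U -> 'End(g)) :
  (forall u x, L' u (L u x) = x) ->
  (forall u x y, L u (br x y) = br (L u x) (L u y)) ->
  let phi := fun f u => L u (f u) : g in
  phi @` M = N -> (forall d, phi @` Md d = Nd d) ->
  graded_lie_module br A Ad M Md -> graded_lie_module br A Ad N Nd.
Proof.
move=> LK Lbr phi MN MNd HM.
have phiD f h : fadd (phi f) (phi h) = phi (fadd f h).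
  by apply/funext => u; rewrite /phi /fadd linearD.
have phiZ a f : fscale a (phi f) = phi (fscale a f).
  by apply/funext => u; rewrite /phi /fscale linearZ.
have phib f h : fbr br (phi f) (phi h) = phi (fbr br f h).
  by apply/funext => u; rewrite /phi /fbr Lbr.
split.
- move=> f h; rewrite -MN => -[f' Mf <-] [h' Mh <-]; rewrite phiD.
  by exists (fadd f' h') => //; exact: (gm_add HM).
- move=> a f Aa; rewrite -MN => -[f' Mf <-]; rewrite phiZ.
  by exists (fscale a f') => //; exact: (gm_scale HM).
- move=> f h; rewrite -MN => -[f' Mf <-] [h' Mh <-]; rewrite phib.
  by exists (fbr br f' h') => //; exact: (gm_br HM).
- by move=> d f; rewrite -MN -MNd => -[f' Mf <-]; exists f' => //; exact: (gm_sub HM) Mf.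
- move=> d; rewrite -MNd; exists (fun=> 0); first exact: (gm0 HM).
  by apply/funext => u; rewrite /phi linear0.
- move=> d f h; rewrite -MNd => -[f' Mf <-] [h' Mh <-]; rewrite phiD.
  by exists (fadd f' h') => //; exact: (gm_add_deg HM).
- move=> d e a f Aa; rewrite -!MNd => -[f' Mf <-]; rewrite phiZ.
  by exists (fscale a f') => //; exact: (gm_scale_deg HM).
- move=> d e f h; rewrite -!MNd => -[f' Mf <-] [h' Mh <-]; rewrite phib.
  by exists (fbr br f' h') => //; exact: (gm_br_deg HM).
- move=> f; rewrite -MN => -[f' Mf <-].
  have [s [F [us MF fF]]] := gm_span HM Mf.
  exists s, (fun d => phi (F d)); split=> // [d|u].
    by rewrite -MNd; exists (F d).
  by rewrite /phi fF linear_sum.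
- move=> s F us NF F0 d ds u.
  pose F' d u := L' u (F d u).
  have F'E e : Md e (F' e) /\ phi (F' e) = F e.
    have := NF e; rewrite -MNd => -[f Mf fE].
    suff -> : F' e = f by [].
    by apply/funext => w; rewrite /F' -fE /phi LK.
  have H : F' d u = 0.
    apply: (gm_direct HM us (fun e => (F'E e).1) _ ds) => w.
    by rewrite /F' -linear_sum F0 linear0.
  by rewrite -(F'E d).2 /phi H linear0.
Qed.

Definition graded_sum (Md : int -> set (U -> g)) (f : U -> g) : Prop :=
  exists (s : seq int) (F : int -> U -> g),
    [/\ uniq s, forall d, Md d (F d) & forall u, f u = \sum_(d <- s) F d u].

(** The two families of components are extended by 0 to a common finite set of
    degrees. *)
Lemma graded_sum_add (Md : int -> set (U -> g)) f h :
  (forall d, Md d (fun=> 0)) ->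
  (forall d f h, Md d f -> Md d h -> Md d (fadd f h)) ->
  graded_sum Md f -> graded_sum Md h -> graded_sum Md (fadd f h).
Proof.
move=> M0 MD [s [F [us MF fF]]] [r [K [ur MK hK]]].
pose cut (q : seq int) (J : int -> U -> g) d : U -> g :=
  if d \in q then J d else (fun=> 0).
have Mcut (q : seq int) J : (forall d, Md d (J d)) -> forall d, Md d (cut q J d).
  by move=> MJ d; rewrite /cut; case: ifP.
have sum_cut (q : seq int) J u : uniq q -> {subset q <= undup (s ++ r)} ->
    \sum_(d <- undup (s ++ r)) cut q J d u = \sum_(d <- q) J d u.
  move=> uq sub.
  have pq : perm_eq q [seq d <- undup (s ++ r) | d \in q].
    apply: uniq_perm => //; first by rewrite filter_uniq ?undup_uniq.
    move=> d; rewrite mem_filter; case: (boolP (d \in q)) => //= /sub ->; exact: erefl.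
  rewrite (perm_big _ pq) /= big_filter [RHS]big_mkcond; apply: eq_bigr => d _.
  by rewrite /cut; case: ifP.
exists (undup (s ++ r)), (fun d => fadd (cut s F d) (cut r K d)); split.
- exact: undup_uniq.
- by move=> d; apply: MD; apply: Mcut.
- move=> u; rewrite /fadd big_split /= !sum_cut //; first by rewrite fF hK.
    by move=> d dr; rewrite mem_undup mem_cat dr orbT.
  by move=> d dr; rewrite mem_undup mem_cat dr.
Qed.

End Tensors.

(** * The isomorphism *)

Section Main.
Variables (R : realType) (g : vectType R[i]) (br : g -> g -> g).
Variables (rho : 'M[R[i]]_2 -> 'End(g)) (G : set 'M[R[i]]_2) (P : mpoly 2 R[i]).
Hypotheses (Hbr : lie_bracket br) (Hrho : lie_aut_rep br rho).
Hypothesis detG : forall A, G A -> \det A = 1.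
Hypothesis PG : relatively_invariant G P.
Hypothesis Phom : homogeneous (total_degree P) P.
Hypothesis Pdeg : (0 < total_degree P)%N.
Local Notation U := (nonzeros P).
Local Notation M u := (Phi1 P (val (u : U))).
Local Notation T t := (rho (torus t)).

Let detM (u : U) : \det (M u) = 1. Proof. exact: det_Phi1. Qed.

Let HL := laurent_algebra P.

Lemma inv_ring_algebra : fun_algebra (inv_ring G P).
Proof.
split.
- by move=> c; split; [exact: (fa_cst HL) | move=> A GA u v _].
- move=> f h [Lf If] [Lh Ih]; split; first exact: (fa_add HL).
  by move=> A GA u v uv; rewrite (If A GA u v uv) (Ih A GA u v uv).
- move=> f h [Lf If] [Lh Ih]; split; first exact: (fa_mul HL).
  by move=> A GA u v uv; rewrite (If A GA u v uv) (Ih A GA u v uv).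
Qed.

Let HI := inv_ring_algebra.

(** Invariance of all the coordinates is invariance of the vector. *)
Lemma sourceP f : source g G P f <->
  tensor g (laurent P) f /\
  forall A, G A -> forall u v : U, val u = invmx A *m val v -> f u = f v.
Proof.
split.
  move=> /(tensorP _ HI) sf; split.
    by apply/tensorP => // l; have [] := sf l.
  move=> A GA u v uv; apply: functionals_separate => l.
  by have [_ /(_ A GA u v uv)] := sf l.
move=> [/(tensorP _ HL) Lf If]; apply/(tensorP _ HI) => l; split; first exact: Lf.
by move=> A GA u v uv; rewrite (If A GA u v uv).
Qed.

(** For a coordinate of weight k, degree d means that it is multiplied by
    t^(d + k); the factor t^k is the action of the torus. *)
Lemma source_degP d f : source_deg rho G P d f <-> source g G P f /\
  forall (t : R[i]) (u v : U), t != 0 -> val v = t *: val u -> f v = t ^ d *: T t (f u).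
Proof.
split.
  move=> [m [t [Tt ft]]]; split.
    exists m, t; split=> // i; split=> //.
    by have [k _ [/laurent_deg_sub La Ia]] := Tt i; split.
  move=> s u v s0 vu; rewrite !ft linear_sum scaler_sumr; apply: eq_bigr => i _.
  have [k wk [/(laurent_deg_scales Phom) /(_ s u v s0 vu) -> _]] := Tt i.
  rewrite linearZ /= (rho_torus_weight Hrho s0 wk) !scalerA expfzDr //.
  by congr (_ *: _); rewrite mulrAC.
move=> [sf fs]; have [n [e [k [eb ew]]]] := weight_basis Hrho.
exists n, (fun i : 'I_n => (e`_i, fun u => coord e i (f u))).
split=> [i|u /=]; last first.
  exact: coord_basis eb (memvf _).
exists (k i) => /=; first exact: ew.
have [Li Ii] := tensor_coord e i HI sf; split=> //.
apply: scales_laurent_deg => // t u v t0 vu.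
rewrite (fs t u v t0 vu) linearZ /= (coord_rho_torus Hrho _ _ eb ew t0).
by rewrite expfzDr // -mulrA.
Qed.

Lemma target_degP d f : target_deg rho G P d f <-> target rho G P f /\
  forall (t : R[i]) (u v : U), t != 0 -> val v = t *: val u -> f v = t ^ d *: f u.
Proof.
split.
  move=> [[m [t [Tt ft]]] If]; split.
    split=> //; exists m, t; split=> // i.
    by have [_ /laurent_deg_sub La] := Tt i; split.
  move=> s u v s0 vu; rewrite !ft scaler_sumr; apply: eq_bigr => i _.
  by have [_ /(laurent_deg_scales Phom) /(_ s u v s0 vu) ->] := Tt i; rewrite scalerA.
move=> [[Lf If] fs]; split=> //.
pose b := vbasis {:g}.
exists (\dim {:g}), (fun i => (b`_(val i), fun u => coord b i (f u))).
split=> [i|u /=]; last exact: coord_vbasis (memvf _).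
split=> //=; have Li := tensor_coord b i HL Lf.
apply: scales_laurent_deg => // t u v t0 vu.
by rewrite (fs t u v t0 vu) linearZ.
Qed.

Lemma inv_ring_degP d a : inv_ring_deg G P d a <-> inv_ring G P a /\ scales d a.
Proof.
split=> [[/(laurent_degP Phom Pdeg)[La sa] Ia]|[[La Ia] sa]] //.
by split=> //; apply/(laurent_degP Phom Pdeg).
Qed.

Let tensor_rho (N : U -> 'M[R[i]]_2) f :
  (forall u, \det (N u) = 1) -> (forall i j, laurent P (fun u => N u i j)) ->
  tensor g (laurent P) f -> tensor g (laurent P) (fun u => rho (N u) (f u)).
Proof.
move=> dN LN [m [t [At ft]]]; apply/(tensorP _ HL) => l.
rewrite (_ : (fun u => _) = (fun u => \sum_(i < m) (t i).2 u * l (rho (N u) (t i).1))).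
  apply: (fa_sum HL) => i; apply: (fa_mul HL); first by have [] := At i.
  exact: (rho_regular Hrho HL).
apply/funext => u; rewrite ft !linear_sum; apply: eq_bigr => i _.
by have := functionalZ (l \o rho (N u))%VF ((t i).2 u) (t i).1; rewrite !comp_lfunE.
Qed.

Let invM u : \adj (M u) *m M u = 1%:M.
Proof. by rewrite mul_adj_mx detM. Qed.
Let Minv u : M u *m \adj (M u) = 1%:M.
Proof. by rewrite mul_mx_adj detM. Qed.
Let det_adjM u : \det (\adj (M u)) = 1.
Proof. by have := congr1 determinant (invM u); rewrite det_mulmx detM mulr1 det1. Qed.

Let rhoK u x : rho (\adj (M u)) (rho (M u) x) = x.
Proof. by rewrite -comp_lfunE -(repM Hrho) // invM (rep1 Hrho) id_lfunE. Qed.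
Let rhoVK u x : rho (M u) (rho (\adj (M u)) x) = x.
Proof. by rewrite -comp_lfunE -(repM Hrho) // Minv (rep1 Hrho) id_lfunE. Qed.

Let laurent_adj i j : laurent P (fun u => \adj (M u) i j).
Proof.
have -> : (fun u : U => \adj (M u) i j) =
    (fun u => (-1) ^+ (j + i) * M u (lift j ord0) (lift i ord0)).
  by apply/funext => u; rewrite mxE /cofactor det_mx11 !mxE.
by apply: (fa_mul HL); [exact: (fa_cst HL) | exact: laurent_Phi1].
Qed.

Let M_equivariant A (u v : U) : G A -> val u = invmx A *m val v -> M v = A *m M u.
Proof.
move=> GA uv; have [c Pc] := PG GA.
have UA : A \in unitmx by rewrite unitmxE (detG GA) unitr1.
rewrite uv (Phi1_equivariant (c := c)) //.
- by rewrite mulmxA mulmxV // mul1mx.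
- by rewrite det_inv (detG GA) invr1.
- by rewrite -uv; exact: (valP u).
Qed.

Let M_scale (t : R[i]) (u v : U) : t != 0 -> val v = t *: val u ->
  M v = M u *m torus t^-1.
Proof. by move=> t0 ->; exact: Phi1_scale. Qed.

Let Psi (f : U -> g) : U -> g := fun u => rho (\adj (M u)) (f u).

Let PsiK f : Phi P rho (Psi f) = f.
Proof. by apply/funext => u; exact: rhoVK. Qed.

Let Phi_target f : source g G P f -> target rho G P (Phi P rho f).
Proof.
move=> /sourceP[Lf If]; split.
  by apply: tensor_rho => //; exact: laurent_Phi1.
move=> A GA u v uv; rewrite /Phi (M_equivariant GA uv) (repM Hrho (detG GA) (detM u)).
by rewrite comp_lfunE (If A GA u v uv).
Qed.

Let Psi_source f : target rho G P f -> source g G P (Psi f).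
Proof.
move=> [Lf If]; apply/sourceP; split; first exact: tensor_rho.
move=> A GA u v uv; rewrite /Psi -(If A GA u v uv).
have -> : rho A (f u) = rho (M v) (rho (\adj (M u)) (f u)).
  by rewrite (M_equivariant GA uv) (repM Hrho (detG GA) (detM u)) comp_lfunE rhoVK.
by rewrite rhoK.
Qed.

Let Phi_deg d : Phi P rho @` source_deg rho G P d = target_deg rho G P d.
Proof.
apply/seteqP; split=> [_ [f /source_degP[sf fs] <-]|f /target_degP[tf fs]].
  apply/target_degP; split; first exact: Phi_target.
  move=> t u v t0 vu; have t0' : t^-1 != 0 by rewrite invr_eq0.
  rewrite /Phi (M_scale t0 vu) (repM Hrho) ?det_torus // comp_lfunE.
  rewrite (fs t u v t0 vu) [T _ (_ *: _)]linearZ linearZ /=.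
  rewrite -[T _ (T _ _)]comp_lfunE -(rho_torusM Hrho) // mulVf //.
  by rewrite (rho_torus1 Hrho) id_lfunE.
exists (Psi f); last exact: PsiK.
apply/source_degP; split; first exact: Psi_source.
move=> t u v t0 vu; have t0' : t^-1 != 0 by rewrite invr_eq0.
rewrite /Psi (fs t u v t0 vu).
have E x : x = rho (M v) (T t (rho (\adj (M u)) x)).
  rewrite (M_scale t0 vu) (repM Hrho) ?det_torus // comp_lfunE.
  rewrite -[T _ (T _ _)]comp_lfunE -(rho_torusM Hrho) // mulVf //.
  by rewrite (rho_torus1 Hrho) id_lfunE rhoVK.
by rewrite {1}[f u]E linearZ /= rhoK.
Qed.

(** The bracket respects degrees because rho (torus t) is an automorphism of
    g.  A source element is a combination of weight vectors with invariant
    coefficients; the homogeneous components of such a coefficient are again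
    invariant, since the group commutes with scaling. *)
Let source_graded : graded_lie_module br (inv_ring G P) (inv_ring_deg G P)
  (source g G P) (source_deg rho G P).
Proof.
have sD f h : source g G P f -> source g G P h -> source g G P (fadd f h).
  move=> /(tensorP _ HI) sf /(tensorP _ HI) sh; apply/(tensorP _ HI) => l.
  rewrite (_ : (fun u => _) = (fun u => l (f u) + l (h u))); first exact: (fa_add HI).
  by apply/funext => u; exact: functionalD.
have sZ a f : inv_ring G P a -> source g G P f -> source g G P (fscale a f).
  move=> Ia /(tensorP _ HI) sf; apply/(tensorP _ HI) => l.
  rewrite (_ : (fun u => _) = (fun u => a u * l (f u))); first exact: (fa_mul HI).
  by apply/funext => u; exact: functionalZ.
have s0 d : source_deg rho G P d (fun=> 0).
  apply/source_degP; split; last by move=> *; rewrite linear0 scaler0.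
  apply/(tensorP _ HI) => l.
  rewrite (_ : (fun u => _) = (fun=> 0)); first exact: (fa_cst HI).
  by apply/funext => u; rewrite linear0.
have sDd d f h : source_deg rho G P d f -> source_deg rho G P d h ->
    source_deg rho G P d (fadd f h).
  move=> /source_degP[sf fs] /source_degP[sh hs]; apply/source_degP.
  split; first exact: sD.
  by move=> t u v t0 vu; rewrite /fadd (fs t u v t0 vu) (hs t u v t0 vu) linearD scalerDr.
split=> //.
- by move=> f h; exact: (tensor_br Hbr HI).
- by move=> d f /source_degP[].
- move=> d e a f /inv_ring_degP[Ia sa] /source_degP[sf fs]; apply/source_degP.
  split; first exact: sZ.
  move=> t u v t0 vu; rewrite /fscale (fs t u v t0 vu) (sa t u v t0 vu).
  by rewrite [T t (_ *: _)]linearZ /= !scalerA expfzDr // mulrAC.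
- move=> d e f h /source_degP[sf fs] /source_degP[sh hs]; apply/source_degP.
  split; first exact: (tensor_br Hbr HI).
  move=> t u v t0 vu; rewrite /fbr (fs t u v t0 vu) (hs t u v t0 vu).
  by rewrite (brZ_l Hbr) (brZ_r Hbr) scalerA -expfzDr // -(rep_br Hrho) ?det_torus.
- move=> f sf; have [n [e [k [eb ew]]]] := weight_basis Hrho.
  have fE : f = (fun u => \sum_(i < n) coord e i (f u) *: e`_i).
    by apply/funext => u; exact: coord_basis eb (memvf _).
  rewrite fE.
  have Ic (i : 'I_n) : inv_ring G P (fun u => coord e i (f u)).
    exact: tensor_coord HI sf.
  have pure (i : 'I_n) a : inv_ring G P a ->
      graded_sum (source_deg rho G P) (fun u => a u *: e`_i).
    move=> [La Ia]; have [s [F [us LF aF]]] := laurent_span Pdeg La.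
    have IF d : d \in s -> inv_ring_deg G P d (F d).
      move=> ds; split=> //; move=> A GA u v uv; apply/eqP; rewrite -subr_eq0; apply/eqP.
      apply: (@laurent_polynomial_eq0 _ s (fun d => F d u - F d v) us _ d ds) => t t0.
      have [tu tuE] := nonzero_scale Phom u t0.
      have [tv tvE] := nonzero_scale Phom v t0.
      have tuv : val tu = invmx A *m val tv by rewrite tuE tvE uv scalemxAr.
      have := Ia A GA tu tv tuv; rewrite !aF => /eqP; rewrite -subr_eq0 -sumrB => /eqP E.
      rewrite -[RHS]E; apply: eq_bigr => d' _.
      have sF := laurent_deg_scales Phom (LF d').
      by rewrite !(sF _ _ _ t0 tuE) (sF _ _ _ t0 tvE) mulrBr.
    exists [seq d - k i | d <- s],
      (fun d u => if d + k i \in s then F (d + k i) u *: e`_i else 0).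
    split.
    + by rewrite map_inj_uniq // => d d' /addIr.
    + move=> d; case: (boolP (d + k i \in s)) => [dks|_]; last exact: s0.
      exists 1%N, (fun _ => (e`_i, F (d + k i))); split=> [_|u]; last by rewrite big_ord1.
      by exists (k i); [exact: ew | exact: IF].
    + move=> u; rewrite big_map aF scaler_suml big_seq [RHS]big_seq.
      by apply: eq_bigr => d ds; rewrite subrK ds.
  have gsum (m : nat) (a : 'I_m -> U -> g) :
      (forall i, graded_sum (source_deg rho G P) (a i)) ->
      graded_sum (source_deg rho G P) (fun u => \sum_(i < m) a i u).
    elim: m a => [|m IH] a Ha.
      exists [::], (fun=> fun=> 0); split=> // u.
      by rewrite big_nil big_ord0.
    rewrite (_ : (fun u => _) = fadd (a ord0) (fun u => \sum_(i < m) a (lift ord0 i) u)).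
      by apply: graded_sum_add => //; apply: IH.
    by apply/funext => u; rewrite big_ord_recl.
  by apply: gsum => i; exact: pure.
- move=> s F us sF F0 d ds u; apply: functionals_separate => l; rewrite linear0.
  apply: (@laurent_polynomial_eq0 _ s (fun d => l (F d u)) us _ d ds) => t t0.
  have [v vu] := nonzero_scale Phom u t0.
  have t0' : t^-1 != 0 by rewrite invr_eq0.
  have E : \sum_(d <- s) t ^ d *: F d u = 0.
    have <- : T t^-1 (\sum_(d <- s) F d v) = \sum_(d <- s) t ^ d *: F d u.
      rewrite linear_sum; apply: eq_bigr => d' _.
      have [_ /(_ t u v t0 vu) ->] := (source_degP _ _).1 (sF d').
      rewrite linearZ /= -[T _ (T _ _)]comp_lfunE -(rho_torusM Hrho) // mulVf //.
      by rewrite (rho_torus1 Hrho) id_lfunE.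
    by rewrite F0 linear0.
  transitivity (l (\sum_(d <- s) t ^ d *: F d u)); last by rewrite E; exact: linear0.
  by rewrite linear_sum; apply: eq_bigr => d' _; exact: esym (functionalZ _ _ _).
Qed.

Lemma Phi_graded_iso : graded_lie_module_iso br (inv_ring G P) (inv_ring_deg G P)
  (source g G P) (source_deg rho G P) (target rho G P) (target_deg rho G P) (Phi P rho).
Proof.
have Phi_img : Phi P rho @` source g G P = target rho G P.
  apply/seteqP; split=> [_ [f sf <-]|f tf]; first exact: Phi_target.
  by exists (Psi f); [exact: Psi_source | exact: PsiK].
have Phi_br u x y : rho (M u) (br x y) = br (rho (M u) x) (rho (M u) y).
  exact: (rep_br Hrho).
split.
- exact: source_graded.
- exact: (graded_transport (L := fun u => rho (M u)) rhoK Phi_br Phi_img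
    Phi_deg source_graded).
- split.
  + by move=> f sf; exact: Phi_target.
  + move=> f h _ _ E; apply/funext => u.
    have /(congr1 (rho (\adj (M u)))) := congr1 (fun F : U -> g => F u) E.
    by rewrite /Phi !rhoK.
  + by rewrite -Phi_img.
- by move=> f h _ _; apply/funext => u; rewrite /Phi /fadd linearD.
- by move=> a f _ _; apply/funext => u; rewrite /Phi /fscale linearZ.
- by move=> f h _ _; apply/funext => u; rewrite /Phi /fbr Phi_br.
- exact: Phi_deg.
Qed.

End Main.

(** The case P = 0: there is a single function on the empty set, and it belongs
    to every homogeneous component of both modules, as an empty sum. *)
Lemma Phi_graded_iso_empty (R : realType) (g : vectType R[i])
    (br : g -> g -> g) (rho : 'M[R[i]]_2 -> 'End(g)) (G : set 'M[R[i]]_2)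
    (P : mpoly 2 R[i]) : (nonzeros P -> False) ->
  graded_lie_module_iso br (inv_ring G P) (inv_ring_deg G P)
    (source g G P) (source_deg rho G P)
    (target rho G P) (target_deg rho G P) (Phi P rho).
Proof.
move=> noU.
have span T (f : nonzeros P -> g) : tensor_span T f.
  exists 0%N, (fun _ => (0, fun u => False_rect _ (noU u))).
  by split=> [[]|u]; [|case: (noU u)].
have inv act (f : nonzeros P -> g) : invariants P G act f.
  by move=> A _ u; case: (noU u).
have fE (f h : nonzeros P -> g) : f = h by apply/funext => u; case: (noU u).
have all_graded M Md : (forall f, M f) -> (forall d f, Md d f) ->
    graded_lie_module br (inv_ring G P) (inv_ring_deg G P) M Md.
  move=> HM HMd; split=> //.
  - by move=> d f _; exact: HM.
  - move=> f _; exists [::], (fun=> fun=> 0); split=> // u; case: (noU u).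
split.
- by apply: all_graded => *; exact: span.
- by apply: all_graded => *; (split; [exact: span | exact: inv]).
- split.
  + by move=> f _; split; [exact: span | exact: inv].
  + by move=> f h _ _ _; exact: fE.
  + by move=> f _; exists f; [exact: span | exact: fE].
- by move=> *; exact: fE.
- by move=> *; exact: fE.
- by move=> *; exact: fE.
- move=> d; apply/seteqP; split=> f _; first by split; [exact: span | exact: inv].
  by exists f; [exact: span | exact: fE].
Qed.

Theorem theorem3p3 (R : realType) (g : vectType R[i]) (br : g -> g -> g)
    (rho : 'M[R[i]]_2 -> 'End(g)) (Gamma : {fset 'M[R]_3})
    (S : set {vspace 'cV[R[i]]_2}) (P : mpoly 2 R[i]) :
  lie_bracket br ->
  lie_aut_rep br rho ->
  polyhedral Gamma ->
  is_orbit (binary_group Gamma) S ->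
  homogeneous #|` Gamma | P ->
  zero_set P = S ->
  relatively_invariant (binary_group Gamma) P ->
  let G := binary_group Gamma in
  graded_lie_module_iso br
    (inv_ring G P) (inv_ring_deg G P)
    (source g G P) (source_deg rho G P)
    (target rho G P) (target_deg rho G P)
    (Phi P rho).
Proof.
move=> Hbr Hrho [_ Gamma1 _ _] _ hP _ PG G.
(* A point outside the zeros of P gives P != 0, hence deg P = |Gamma| > 0. *)
have [u|noU] := pselect (exists u : nonzeros P, True); last first.
  by apply: Phi_graded_iso_empty => u; apply: noU; exists u.
have P0 : P != 0.
  case: u => -[v Pv] _; apply: contraNneq Pv => ->.
  by rewrite -mpolyC0 polyevalC.
have degP : #|` Gamma| = total_degree P.
  exact: dhomog_uniq P0 hP (dhomog_msize hP).
have Phom : homogeneous (total_degree P) P by rewrite -degP.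
have Pdeg : (0 < total_degree P)%N.
  by rewrite -degP cardfs_gt0; apply/fset0Pn; exists 1%:M.
have detG A : G A -> \det A = 1 by case.
exact: Phi_graded_iso Hbr Hrho detG PG Phom Pdeg.
Qed.
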